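(* Let $A\in\mathcal{A}\subseteq\mathbb{R}^k$ be a continuous random vector and assume the linear marginal structural model $\int\mu_a(x)\,d\mathbb{P}(x)=\psi_0+\sum_{j=1}^k\psi_ja_j$ for all $a\in\mathcal{A}$, with known intercept $\psi_0\in\mathbb{R}$ and $\psi\in\mathbb{R}^k$ satisfying $\|\psi\|_0\le s$. Let $\widehat\psi$ be either the Lasso estimator $\widehat\psi_{\text{lasso}}$ or the best subset selection estimator $\widehat\psi_{\text{subset}}$ (defined in the context). Assume (i) $\widehat\pi_a(X)\ge\epsilon$ for all $a\in\mathcal{A}$ almost surely; (ii) the eigenvalues of $\int_{\mathcal{A}}aa^T\widehat p(a)\,da$ are lower bounded by $C$; (iii) $|Y|,\ |\widehat\mu|,\ |\psi_0|,\ \|A\|_\infty,\ \widehat p,\ \int_{\mathcal{A}}\widehat p(a)\,da\le B$ almost surely, for constants $B,C,\epsilon>0$ independent of $k$ and $n$. Assume $\delta_n(a)\le\delta_n$ and $\epsilon_n(a)\le\epsilon_n$ for all $a\in\mathcal{A}$. Then, for $\log k\lesssim n$, $$\mathbb{E}\left(\int_{\mathcal{A}}\{a^T(\widehat\psi-\psi)\}^2\,\widehat p(a)\,da\right)\lesssim s\,\frac{\log k}{n}+s(\delta_n\epsilon_n)^2.$$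
   Context: $Z=(X,A,Y)\sim\mathbb{P}$ with $X\in\mathbb{R}^d$, $A\in\mathcal{A}=\mathrm{supp}(A)\subseteq\mathbb{R}^k$, $Y\in\mathbb{R}$. $D_1$ and $D_2=(Z_1,\dots,Z_n)$ are two independent samples, each of $n$ i.i.d. copies of $Z$; $\mathbb{P}_n^2$ is the sample average over $D_2$. $\mu_a(x)=\mathbb{E}(Y\mid X=x,A=a)$; $\pi_a(x)>0$ is the conditional (Lebesgue) density of $A$ at $a$ given $X=x$. $\widehat\mu_a,\widehat\pi_a$ are (arbitrary) estimators of $\mu_a,\pi_a$ and $\widehat p$ is an estimator of the marginal density of $A$, all constructed from $D_1$ only. With $\|f\|=(\int f(x)^2\,d\mathbb{P}(x))^{1/2}$ (with $D_1$ held fixed), $\delta_n(a)=\|\pi_a/\widehat\pi_a-1\|$, $\epsilon_n(a)=\|\mu_a-\widehat\mu_a\|$; $\delta_n,\epsilon_n$ are non-random. Empirical risk, for $\beta\in\mathbb{R}^k$: $$\widehat R(\beta)=-2\,\mathbb{P}_n^2\left\{\frac{Y-\widehat\mu_A(X)}{\widehat\pi_A(X)/\widehat p(A)}A^T\beta+\int_{\mathcal{A}}(\widehat\mu_a(X)-\psi_0)\,a^T\beta\,\widehat p(a)\,da\right\}+\int_{\mathcal{A}}(a^T\beta)^2\,\widehat p(a)\,da.$$ Estimators: $\widehat\psi_{\text{lasso}}\in\arg\min_{\|\beta\|_1\le t}\widehat R(\beta)$ with constraint level chosen as the true value $t=\|\psi\|_1$, and $\widehat\psi_{\text{subset}}\in\arg\min_{\|\beta\|_0\le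 s}\widehat R(\beta)$, where $\|v\|_1=\sum_j|v_j|$, $\|v\|_0=\#\{j:v_j\ne0\}$. $\lesssim$ means inequality up to a multiplicative constant not depending on $n,k,s,\delta_n,\epsilon_n$ (it may depend on the constants in the assumptions).
   Formalization: The theorem assumes k ≥ 2 and n ≥ 1 (for k = 1, log k = 0 and the bound fails, e.g. when δ_n = ε_n = 0 and Y is noisy), and takes the density estimator p̂ to be nonnegative, so that p̂ ≤ B and ∫p̂ ≤ B are genuine bounds. *)

(* Defs.v *)
From HB Require Import structures.
From mathcomp Require Import all_boot all_order all_algebra.
From mathcomp Require Import all_classical all_reals all_analysis.
Import Order.TTheory GRing.Theory Num.Theory.
Import numFieldNormedType.Exports.

Set Implicit Arguments.
Unset Strict Implicit.
Unset Printing Implicit Defensive.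

Local Open Scope classical_set_scope.
Local Open Scope ring_scope.

(* Vectors of R^m are [m.-tuple R], which carry the product sigma-algebra. *)

Section lebesgue_Rn.
Context {R : realType}.

Definition consRn m (u : measurableTypeR R * m.-tuple R) : m.+1.-tuple R :=
  [the m.+1.-tuple R of u.1 :: u.2].

Lemma measurable_consRn m :
    measurable_fun [set: measurableTypeR R * m.-tuple R] (@consRn m).
Proof. exact: measurable_cons. Qed.

Section step.
Context (m : nat) (mu : {sigma_finite_measure set (m.-tuple R) -> \bar R}).

Definition lebesgue_Rn_step : set (m.+1.-tuple R) -> \bar R :=
  pushforward (@lebesgue_measure R \x mu)%E (@consRn m).

Let step0 : lebesgue_Rn_step set0 = 0%E.
Proof. by rewrite /lebesgue_Rn_step /pushforward preimage_set0 measure0. Qed.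

Let step_ge0 S : (0 <= lebesgue_Rn_step S)%E.
Proof. exact: (measure_ge0 (@lebesgue_measure R \x mu)%E). Qed.

Let step_sigma_additive : semi_sigma_additive lebesgue_Rn_step.
Proof.
move=> F mF tF mUF; rewrite /lebesgue_Rn_step /pushforward preimage_bigcup.
have mc i : measurable (@consRn m @^-1` F i).
  by rewrite -[X in measurable X]setTI; exact: measurable_consRn.
apply: measure_semi_sigma_additive => //.
- apply/trivIsetP => /= i j _ _ ij; rewrite -preimage_setI.
  by move/trivIsetP : tF => /(_ _ _ _ _ ij) ->//; rewrite preimage_set0.
- exact: bigcupT_measurable.
Qed.

HB.instance Definition _ := isMeasure.Build _ _ _ lebesgue_Rn_step
  step0 step_ge0 step_sigma_additive.

Let sigma_finite_step : sigma_finite setT lebesgue_Rn_step.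
Proof.
pose g (t : m.+1.-tuple R)  : measurableTypeR R * m.-tuple R :=
  (thead t, [tuple of behead t]).
have mg : measurable_fun setT g.
  apply: measurable_fun_pair; first exact: measurable_tnth.
  exact: measurable_behead.
have gK u : g (consRn u) = u.
  by case: u => x t; congr pair; apply/val_inj.
have /sigma_finiteP[F [FT ndF Foo]] := sigma_finiteT (@lebesgue_measure R).
have /sigma_finiteP[G [GT ndG Goo]] := sigma_finiteT mu.
exists (fun i => g @^-1` (F i `*` G i)).
  apply/esym/seteqP; split=> // t _.
  have : setT (thead t) by [].
  have : setT [tuple of behead t] by [].
  rewrite FT GT => -[j _ Gj] [i _ Fi]; exists (maxn i j) => //; split => /=.
    by move: (thead t) Fi; exact/subsetPset/ndF/leq_maxl.
  by move: [tuple of behead t] Gj; exact/subsetPset/ndG/leq_maxr.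
move=> i; have [mF Fi] := Foo i; have [mG Gi] := Goo i; split.
  by rewrite -[_ @^-1` _]setTI; apply: mg => //; exact: measurableX.
rewrite /lebesgue_Rn_step /pushforward -comp_preimage.
rewrite (_ : g \o _ = id); last by apply/funext => u /=; exact: gK.
by rewrite preimage_id product_measure1E// lte_mul_pinfty// ge0_fin_numE.
Qed.

HB.instance Definition _ :=
  Measure_isSigmaFinite.Build _ _ _ lebesgue_Rn_step sigma_finite_step.

End step.

(* Lebesgue measure on R^m, by recursion on m: the point mass on R^0, and the
   image of the product of the Lebesgue measures of R and R^m under
   (x, t) |-> x :: t on R^{m+1}. *)
Fixpoint lebesgue_Rn (m : nat) :
    {sigma_finite_measure set (m.-tuple R) -> \bar R} :=
  match m with
  | 0 => [the {sigma_finite_measure set (0.-tuple R) -> \bar R} of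
           \d_([tuple] : 0.-tuple R)]
  | m'.+1 => [the {sigma_finite_measure set (m'.+1.-tuple R) -> \bar R} of
               lebesgue_Rn_step (lebesgue_Rn m')]
  end.

End lebesgue_Rn.

Section vectors.
Context {R : realType} {m : nat}.
Implicit Types u v : m.-tuple R.

Definition dotRn u v : R := \sum_(j < m) tnth u j * tnth v j.

Definition subRn u v : m.-tuple R := [tuple tnth u j - tnth v j | j < m].

Definition l1norm v : R := \sum_(j < m) `|tnth v j|.

Definition l0norm v : nat := #|[pred j : 'I_m | tnth v j != 0]|.

End vectors.

Definition is_argmin {R : realType} (T : Type) (D : set T) (f : T -> R)
    (x : T) : Prop :=
  D x /\ forall y, D y -> f x <= f y.

(* The observation Z = (X, A, Y), as a point of R^d x R^k x R. *)
Notation obs R d k := (d.-tuple R * k.-tuple R * R)%type.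

Section observations.
Context {R : realType} {d k : nat}.

Definition obsX (z : obs R d k) : d.-tuple R := z.1.1.
Definition obsA (z : obs R d k) : k.-tuple R := z.1.2.
Definition obsY (z : obs R d k) : R := z.2.

Variable Q : probability (obs R d k) R.

(* The closed support of the law of A, in terms of sup-norm balls. *)
Definition suppA : set (k.-tuple R) :=
  [set a | forall r : R, 0 < r ->
    (0 < Q [set z | forall j : 'I_k, `|tnth (obsA z) j - tnth a j| < r]%R)%E].

(* [mu x a] is a version of E(Y | X = x, A = a). *)
Definition is_regression (mu : d.-tuple R -> k.-tuple R -> R) : Prop :=
  [/\ measurable_fun [set: d.-tuple R * k.-tuple R] (fun u => mu u.1 u.2),
      Q.-integrable setT (fun z => (obsY z)%:E),
      Q.-integrable setT (fun z => (mu (obsX z) (obsA z))%:E) &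
      forall S : set (d.-tuple R * k.-tuple R), measurable S ->
        (\int[Q]_(z in [set z | S (obsX z, obsA z)])
            (mu (obsX z) (obsA z))%:E =
         \int[Q]_(z in [set z | S (obsX z, obsA z)]) (obsY z)%:E)%E].

(* [pi_ x a] is a version of the conditional Lebesgue density of A at a given
   X = x, positive at every a in the support of A. *)
Definition is_positive_cond_density (pi_ : d.-tuple R -> k.-tuple R -> R) :
    Prop :=
  [/\ measurable_fun [set: d.-tuple R * k.-tuple R] (fun u => pi_ u.1 u.2),
      forall x a, 0 <= pi_ x a,
      forall (S : set (d.-tuple R)) (S' : set (k.-tuple R)),
        measurable S -> measurable S' ->
        (Q [set z | S (obsX z) /\ S' (obsA z)] =
         \int[Q]_(z in [set z | S (obsX z)])
           \int[lebesgue_Rn k]_(a in S') (pi_ (obsX z) a)%:E)%E &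
      forall a, suppA a -> {ae Q, forall z, 0 < pi_ (obsX z) a}].

Definition normX (f : d.-tuple R -> R) : \bar R :=
  Lnorm Q 2%:E (fun z => (f (obsX z))%:E).

End observations.

Section samples.
Context {R : realType} {dO : measure_display} {T : measurableType dO}
  (P : probability T R).

Definition indep_rv {d1 d2 : measure_display} {E1 : measurableType d1}
    {E2 : measurableType d2} (U : {RV P >-> E1}) (V : {RV P >-> E2}) : Prop :=
  forall (S1 : set E1) (S2 : set E2), measurable S1 -> measurable S2 ->
    P (U @^-1` S1 `&` V @^-1` S2) = (P (U @^-1` S1) * P (V @^-1` S2))%E.

(* The components of D are mutually independent, each with law Q.  The product
   rule for all n components gives it for every subfamily, by taking some of
   the S i to be the whole space. *)
Definition iid_sample {dE : measure_display} {E : measurableType dE} {n : nat}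
    (D : {RV P >-> n.-tuple E}) (Q : probability E R) : Prop :=
  (forall (i : 'I_n) (S : set E), measurable S ->
     P [set w | S (tnth (D w) i)] = Q S) /\
  (forall S : 'I_n -> set E, (forall i, measurable (S i)) ->
     P [set w | forall i : 'I_n, S i (tnth (D w) i)] =
     (\prod_(i < n) P [set w | S i (tnth (D w) i)])%E).

End samples.

Section empirical_risk.
Context {R : realType} {d k n : nat}.

(* The empirical risk on the second sample [D2], for estimators [muhat],
   [pihat], [phat] that are already evaluated at the first sample; [calA] is
   the support of A.  Since x / 0 = 0, the first term vanishes when
   [phat (obsA z) = 0], as it should. *)
Definition emp_risk (calA : set (k.-tuple R)) (psi0 : R)
    (muhat pihat : d.-tuple R -> k.-tuple R -> R) (phat : k.-tuple R -> R)
    (D2 : n.-tuple (obs R d k)) (beta : k.-tuple R) : R :=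
  - 2%:R * (n%:R^-1 * \sum_(i < n)
      (let z := tnth D2 i in
       (obsY z - muhat (obsX z) (obsA z)) /
         (pihat (obsX z) (obsA z) / phat (obsA z)) * dotRn (obsA z) beta
       + \int[lebesgue_Rn k]_(a in calA)
           ((muhat (obsX z) a - psi0) * dotRn a beta * phat a)))
  + \int[lebesgue_Rn k]_(a in calA) (dotRn a beta ^+ 2 * phat a).

Definition second_moment (calA : set (k.-tuple R)) (phat : k.-tuple R -> R) :
    'M[R]_k :=
  \matrix_(i, j) \int[lebesgue_Rn k]_(a in calA)
                    (tnth a i * tnth a j * phat a).

End empirical_risk.

(* Main.v *)
Require Import Defs.
From HB Require Import structures.
From mathcomp Require Import all_boot all_order all_algebra.
From mathcomp Require Import all_classical all_reals all_analysis.
From mathcomp Require Import measurable_realfun ring lra.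
Import Order.TTheory GRing.Theory Num.Theory.
Import numFieldNormedType.Exports.

Set Implicit Arguments.
Unset Strict Implicit.
Unset Printing Implicit Defensive.

Local Open Scope classical_set_scope.
Local Open Scope ring_scope.

(** Fix the first sample and let [Sigma] be the second moment matrix of [phat]
over the support [S] of [A].  With [D = psihat - psi], the quantity to bound is
the expectation of [q = D^T Sigma D].

The empirical risk is the quadratic function [- 2 b . h + b^T Sigma b] of [b],
where [h] is the average over the second sample of a vector, the [score] of an
observation.  Comparing the risks of [psihat] and [psi] gives [q <= 2 D . g]
with [g = h - Sigma psi].  For the Lasso tuned at the true level, [D] lies in
the cone where the coordinates off the support of [psi] weigh at most as much
as those on it; for best subset selection, [D] is 2s-sparse.  In both cases
[|D|_1^2 <= 4 s |D|_2^2], and [q >= C |D|_2^2] because the smallest eigenvalue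
of [Sigma] is the minimum of its Rayleigh quotient.  Hence
[q <= (16 / C) s max_j g_j^2] ([argmin_excess_risk]).

It remains to bound [g], which is a bias plus a centered average.

The bias is doubly robust ([score_bias]).  Replace [Y] by [mu_A(X)], then
integrate out [A] with its conditional density, then use the structural model
to write [Sigma psi] through the means of [mu_a(X)].  What is left is the
integral over [a] in [S] of [a phat(a) E[(mu_a - muhat_a)(pi_a / pihat_a - 1)]],
and Cauchy-Schwarz bounds each coordinate by [B^2 delta eps].

The centered average has, given the first sample, [k] coordinates that are
means of [n] independent bounded centered variables, so that their exponential
moments are sub-Gaussian ([iid_mean_mgf]).  A square is at most a threshold
[r^2] plus a small multiple of an exponential ([sqr_le_exp_tails]).  Summing the
exponentials over the [k] coordinates and taking [r^2] of order [log k / n]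
bounds the expected maximum of the squares by a multiple of [log k / n]
([tuned_tail]).

The hypotheses on the first sample hold for almost every outcome [w], but they
are not measurable conditions on [D1 w].  They are therefore only used to bound,
for almost every [w], inner integrals over the second sample that are measurable
functions of [D1 w] ([indep_integral], [indep_integral_le], [indep_ae]). *)

(** * Exponential inequalities *)

(** Once integrated against a centered variable the linear term vanishes, which
leaves a sub-Gaussian bound.  Below [1/2], [expR x <= (1 - x)^-1 <= 1 + x + 2 x^2];
above it, [x <= 2 x^2]. *)
Lemma expR_le_add_expR_sq (R : realType) (x : R) :
  expR x <= x + expR (2 * x ^+ 2).
Proof.
have [x0|x0] := lerP x 2^-1; last first.
  have x2 : x <= 2 * x ^+ 2 by nra.
  rewrite (@le_trans _ _ (expR (2 * x ^+ 2)))// ?ler_expR//.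
  by rewrite lerDr; lra.
have p : 0 < 1 - x by lra.
have h1 : expR x <= (1 - x)^-1.
  rewrite -[leLHS]invrK lef_pV2 ?posrE ?invr_gt0 ?expR_gt0// -expRN.
  exact: expR_ge1Dx.
apply: (le_trans h1); rewrite -[leLHS]mul1r ler_pdivrMr//.
have h2 := expR_ge1Dx (2 * x ^+ 2).
apply: (@le_trans _ _ ((x + (1 + 2 * x ^+ 2)) * (1 - x))).
  by rewrite -subr_ge0 (_ : _ - 1 = x ^+ 2 * (1 - 2 * x)); [nra|ring].
by apply: ler_wpM2r; [exact: ltW|rewrite lerD2l].
Qed.

(** Write [|x| = r + y].  If [y > 0], then [|x|^2 - r^2 = 2 r y + y^2] and both
terms are at most multiples of [expR (l * y)]. *)
Lemma sqr_le_exp_tails (R : realType) (l r x : R) : 0 < l -> 0 <= r ->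
  x ^+ 2 <= r ^+ 2 + (2 * r / l + 4 / l ^+ 2) * expR (- (l * r)) *
    (expR (l * x) + expR (- (l * x))).
Proof.
move=> l0 r0.
set K := _ * expR _.
have K0 : 0 <= K.
  by rewrite mulr_ge0 ?expR_ge0// addr_ge0// divr_ge0 ?exprn_ge0// ?mulr_ge0// ltW.
suff H (y : R) : 0 <= y -> y ^+ 2 <= r ^+ 2 + K * expR (l * y).
  have [x0|x0] := leP 0 x.
    by rewrite (le_trans (H _ x0))// lerD2l ler_wpM2l// lerDl expR_ge0.
  have := H (- x); rewrite oppr_ge0 sqrrN mulrN => /(_ (ltW x0)) /le_trans; apply.
  by rewrite lerD2l ler_wpM2l// lerDr expR_ge0.
move=> y0; have [yr|ry] := leP y r.
  by rewrite (@le_trans _ _ (r ^+ 2)) ?lerXn2r ?nnegrE// lerDl mulr_ge0 ?expR_ge0.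
pose t := l * (y - r).
have t0 : 0 < t by rewrite mulr_gt0// subr_gt0.
have -> : K * expR (l * y) = (2 * r / l + 4 / l ^+ 2) * expR t.
  rewrite /K -mulrA -expRD; congr (_ * expR _); rewrite /t; ring.
have -> : y ^+ 2 = r ^+ 2 + (2 * r / l * t + 4 / l ^+ 2 * (t ^+ 2 / 4)).
  by rewrite /t; field; rewrite gt_eqF.
rewrite lerD2l [leRHS]mulrDl; apply: lerD.
  rewrite ler_wpM2l ?divr_ge0 ?mulr_ge0//; first exact: ltW.
  by rewrite (le_trans _ (expR_ge1Dx _))// lerDr.
rewrite ler_wpM2l ?divr_ge0 ?exprn_ge0//; first exact: ltW.
have h := expR_ge1Dx (t / 2).
have -> : expR t = expR (t / 2) ^+ 2 by rewrite -expRM_natl; congr expR; field.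
apply: (@le_trans _ _ ((1 + t / 2) ^+ 2)); first by nra.
by rewrite lerXn2r ?nnegrE ?expR_ge0// addr_ge0// divr_ge0// ltW.
Qed.

Lemma ln_nat_ge_half (R : realType) (k : nat) : (1 < k)%N -> 2^-1 <= ln k%:R :> R.
Proof.
move=> k1; rewrite -[leLHS]expRK ler_ln ?posrE ?expR_gt0 ?ltr0n 1?ltnW//.
rewrite (@le_trans _ _ 2)// ?ler_nat//.
rewrite -[leLHS]invrK -[2 in leRHS]invrK lef_pV2 ?posrE ?invr_gt0 ?expR_gt0//.
by rewrite -expRN (le_trans _ (expR_ge1Dx _))//; lra.
Qed.

(** * Quadratic forms and the smallest eigenvalue *)

Definition bilin (R : realType) n (M : 'M[R]_n) (u v : 'rV[R]_n) : R :=
  (u *m M *m v^T) 0 0.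

Lemma bilinE (R : realType) n (M : 'M[R]_n) (u v : 'rV[R]_n) :
  bilin M u v = \sum_i \sum_j u 0 i * M i j * v 0 j.
Proof.
rewrite /bilin mxE exchange_big /=; apply: eq_bigr => j _.
by rewrite !mxE mulr_suml.
Qed.

Lemma bilin1E (R : realType) n (v : 'rV[R]_n) :
  bilin 1%:M v v = \sum_i v 0 i ^+ 2.
Proof.
by rewrite /bilin mulmx1 mxE; apply: eq_bigr => i _; rewrite mxE -expr2.
Qed.

Lemma bilin1_ge0 (R : realType) n (v : 'rV[R]_n) : 0 <= bilin 1%:M v v.
Proof. by rewrite bilin1E sumr_ge0// => i _; exact: sqr_ge0. Qed.

Lemma bilin1_gt0 (R : realType) n (v : 'rV[R]_n) :
  v != 0 -> 0 < bilin 1%:M v v.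
Proof.
move=> v0; rewrite lt_def bilin1_ge0 andbT; apply: contra v0.
rewrite bilin1E psumr_eq0; last by move=> i _; exact: sqr_ge0.
move=> /allP h; apply/eqP/rowP => i; rewrite mxE; apply/eqP.
by rewrite -sqrf_eq0; apply: h; rewrite mem_index_enum.
Qed.

Lemma bilinDZ (R : realType) n (M : 'M[R]_n) (u v : 'rV[R]_n) (t : R) :
  M^T = M ->
  bilin M (u + t *: v) (u + t *: v) =
  bilin M u u + t * (2 * bilin M u v) + t ^+ 2 * bilin M v v.
Proof.
move=> MT; have sym : bilin M v u = bilin M u v.
  rewrite /bilin; transitivity ((v *m M *m u^T)^T 0 0); first by rewrite [RHS]mxE.
  by rewrite !trmx_mul trmxK MT mulmxA.
rewrite /bilin in sym *.
rewrite linearD linearZ /= !mulmxDl !mulmxDr -!scalemxAl -!scalemxAr.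
have D00 (A B : 'M[R]_1) : (A + B) 0 0 = A 0 0 + B 0 0 by rewrite mxE.
have Z00 a (A : 'M[R]_1) : (a *: A) 0 0 = a * A 0 0 by rewrite mxE.
by rewrite !(D00, Z00) sym; ring.
Qed.

(** The form at [u + t v] is nonnegative for every [t]; take the minimizing [t],
or a [t] of large modulus when the form vanishes at [v]. *)
Lemma bilin_CauchySchwarz (R : realType) n (M : 'M[R]_n) (u v : 'rV[R]_n) :
  M^T = M -> (forall w, 0 <= bilin M w w) ->
  bilin M u v ^+ 2 <= bilin M u u * bilin M v v.
Proof.
move=> MT M0.
have H t := M0 (u + t *: v).
have {}H t : 0 <= bilin M u u + t * (2 * bilin M u v) + t ^+ 2 * bilin M v v.
  by rewrite -bilinDZ.
have [v0|v0] := eqVneq (bilin M v v) 0.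
  rewrite v0 mulr0; have [->|b0] := eqVneq (bilin M u v) 0; first by rewrite expr0n.
  have := H (- (bilin M u u + 1) / (2 * bilin M u v)).
  rewrite v0 mulr0 addr0 mulfVK ?mulf_neq0//; lra.
have vp : 0 < bilin M v v by rewrite lt_def v0 M0.
have := H (- bilin M u v / bilin M v v).
set a := bilin M u v; set b := bilin M v v; set d := bilin M u u.
rewrite (_ : _ + _ = d - a ^+ 2 / b); last by field.
by rewrite subr_ge0 ler_pdivrMr.
Qed.

Lemma bilin_bounded (R : realType) n (M : 'M[R]_n) :
  exists2 K : R, 0 < K & forall v, `|bilin M v v| <= K * bilin 1%:M v v.
Proof.
exists (1 + \sum_i \sum_j `|M i j|).
  by rewrite ltr_pwDl// sumr_ge0// => i _; rewrite sumr_ge0.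
move=> v; apply: (@le_trans _ _ ((\sum_i \sum_j `|M i j|) * bilin 1%:M v v)); last first.
  by rewrite ler_wpM2r ?bilin1_ge0// lerDr.
rewrite bilinE mulr_suml (le_trans (ler_norm_sum _ _ _))// ler_sum// => i _.
rewrite mulr_suml (le_trans (ler_norm_sum _ _ _))// ler_sum// => j _.
rewrite !normrM -mulrA mulrCA ler_wpM2l//.
have le1 (l : 'I_n) : `|v 0 l| ^+ 2 <= bilin 1%:M v v.
  rewrite bilin1E (bigD1 l)//= real_normK ?num_real// lerDl sumr_ge0// => ? _.
  exact: sqr_ge0.
have := le1 i; have := le1 j; have := sqr_ge0 (`|v 0 i| - `|v 0 j|); nra.
Qed.

(** Let [m] be the infimum of the Rayleigh quotient.  Then [N = S - m I] is
positive semidefinite.  If [N] were invertible, Cauchy-Schwarz for [N] applied to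
[v] and [v N^-1] would bound the quotient of [N] away from [0], against the
choice of [m].  So [m] is an eigenvalue. *)
Lemma eigenvalue_Rayleigh (R : realType) n (S : 'M[R]_n) (C : R) :
  S^T = S -> (forall l, eigenvalue S l -> C <= l) ->
  forall v : 'rV[R]_n, C * bilin 1%:M v v <= bilin S v v.
Proof.
move=> ST hC v; rewrite leNgt; apply/negP => vC.
have v0 : v != 0.
  by apply: contraTneq vC => ->; rewrite /bilin !mul0mx mxE mulr0 ltxx.
pose E := [set bilin S w w / bilin 1%:M w w | w in [set w : 'rV[R]_n | w != 0]].
have [K K0 hK] := bilin_bounded S.
have Elb : has_inf E.
  split; first by exists (bilin S v v / bilin 1%:M v v); exists v.
  exists (- K) => _ [w /= w0 <-]; rewrite ler_pdivlMr ?bilin1_gt0//.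
  by have := hK w; rewrite ler_norml mulNr => /andP[].
pose m := inf E.
have mC : m < C.
  apply: (@le_lt_trans _ _ (bilin S v v / bilin 1%:M v v)).
    by apply: ge_inf; [exact: Elb.2|exists v].
  by rewrite ltr_pdivrMr ?bilin1_gt0.
pose N := S - m%:M.
have NE w : bilin N w w = bilin S w w - m * bilin 1%:M w w.
  rewrite /bilin /N mulmxBr mulmxBl mul_mx_scalar -scalemxAl mulmx1.
  have B00 (A B : 'M[R]_1) : (A - m *: B) 0 0 = A 0 0 - m * B 0 0.
    by rewrite !mxE.
  exact: B00.
have N0 w : 0 <= bilin N w w.
  have [->|w0] := eqVneq w 0; first by rewrite /bilin !mul0mx mxE.
  rewrite NE subr_ge0 -ler_pdivlMr ?bilin1_gt0//.
  by apply: ge_inf; [exact: Elb.2|exists w].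
have NT : N^T = N by rewrite /N linearB /= ST tr_scalar_mx.
have [Nu|Nu] := boolP (N \in unitmx); last first.
  have : eigenvalue S m.
    rewrite /eigenvalue /eigenspace kermx_eq0 row_free_unit; exact: Nu.
  by move/hC; rewrite leNgt mC.
have [K' K'0 hK'] := bilin_bounded (invmx N).
(* Cauchy-Schwarz at [w] and [w N^-1] bounds the quotient of [N] below. *)
have lb w : w != 0 -> (m + K'^-1) * bilin 1%:M w w <= bilin S w w.
  move=> w0; have wp := bilin1_gt0 w0.
  suff : K'^-1 * bilin 1%:M w w <= bilin N w w by rewrite NE mulrDl; lra.
  pose x := w *m invmx N.
  have xN : x *m N = w by rewrite /x mulmxKV.
  have := bilin_CauchySchwarz x w NT N0.
  have -> : bilin N x w = bilin 1%:M w w by rewrite /bilin xN mulmx1.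
  have -> : bilin N x x = bilin (invmx N) w w.
    rewrite /bilin xN /x trmx_mul trmx_inv NT mulmxA //.
  have := le_trans (ler_norm _) (hK' w).
  have := N0 w.
  set a := bilin _ _ _; set b := bilin _ _ _; set c := bilin _ _ _ in wp *.
  move=> a0 bc cab; rewrite mulrC ler_pdivrMr// -(ler_pM2l wp) -expr2.
  by rewrite (le_trans cab)//; nra.
have : m + K'^-1 <= m.
  apply: lb_le_inf; first exact: Elb.1.
  by move=> _ [w /= w0 <-]; rewrite ler_pdivlMr ?bilin1_gt0// lb.
by rewrite gerDl leNgt invr_gt0 K'0.
Qed.

(** * Sparse errors and the basic inequality *)

Lemma sqr_sum_le_card (R : realType) (I : finType) (A : {pred I}) (x : I -> R) :
  (\sum_(i in A) x i) ^+ 2 <= #|A|%:R * \sum_(i in A) x i ^+ 2.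
Proof.
rewrite expr2 mulr_suml.
apply: (@le_trans _ _ (\sum_(i in A) \sum_(j in A) (x i ^+ 2 + x j ^+ 2) / 2)).
  apply: ler_sum => i _; rewrite mulr_sumr; apply: ler_sum => j _.
  by have := sqr_ge0 (x i - x j); lra.
set S := \sum_(i in A) x i ^+ 2.
have -> : \sum_(i in A) \sum_(j in A) (x i ^+ 2 + x j ^+ 2) / 2 =
    \sum_(i in A) (x i ^+ 2 * (#|A|%:R / 2) + S / 2).
  apply: eq_bigr => i _; rewrite -mulr_suml big_split /= sumr_const.
  by rewrite -/S mulrDl mulrA mulr_natr.
rewrite big_split /= sumr_const -mulr_suml -/S -[X in _ + X]mulr_natl.
by move: #|A|%:R S => c S; lra.
Qed.

(** Off the support of [p] the error is [b] itself, and the constraint on [b]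
leaves it at most the norm that [b] has lost on the support. *)
Lemma l1_le_l2_lasso (R : realType) (k s : nat) (b p : k.-tuple R) :
  (l0norm p <= s)%N -> l1norm b <= l1norm p ->
  l1norm (subRn b p) ^+ 2 <= 4 * s%:R * \sum_j tnth (subRn b p) j ^+ 2.
Proof.
move=> p0 bp; set D := subRn b p.
have DE j : tnth D j = tnth b j - tnth p j by rewrite tnth_mktuple.
pose A := [pred j : 'I_k | tnth p j != 0].
have split f : \sum_j f j = \sum_(j in A) f j + \sum_(j | j \notin A) f j :> R.
  by rewrite (bigID (mem A)).
have cone : l1norm D <= 2 * \sum_(j in A) `|tnth D j|.
  rewrite /l1norm split mulr2n mulrDl mul1r lerD2l.
  move: bp; rewrite /l1norm 2!split.
  rewrite [X in _ <= _ + X]big1 ?addr0; last first.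
    by move=> j; rewrite inE negbK => /eqP ->; rewrite normr0.
  rewrite [X in _ + X <= _](eq_bigr (fun j => `|tnth D j|)); last first.
    by move=> j; rewrite inE negbK DE => /eqP ->; rewrite subr0.
  rewrite -lerBrDl -sumrB => /le_trans; apply; apply: ler_sum => j _.
  by rewrite DE distrC lerB_dist.
have D0 : 0 <= l1norm D by rewrite sumr_ge0.
apply: (@le_trans _ _ ((2 * \sum_(j in A) `|tnth D j|) ^+ 2)).
  by rewrite lerXn2r ?nnegrE// (le_trans D0).
have -> : 4 * s%:R * \sum_j tnth D j ^+ 2 = 2 ^+ 2 * (s%:R * \sum_j tnth D j ^+ 2).
  by rewrite mulrA; congr (_ * _ * _); ring.
rewrite exprMn ler_pM2l ?exprn_gt0//.
apply: (le_trans (sqr_sum_le_card _ _)).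
rewrite ler_pM ?ler_nat//; first by rewrite sumr_ge0// => j _; exact: sqr_ge0.
under eq_bigr do rewrite real_normK ?num_real//.
by rewrite [leRHS]split lerDl sumr_ge0// => j _; exact: sqr_ge0.
Qed.

Lemma l1_le_l2_sparse (R : realType) (k s : nat) (b p : k.-tuple R) :
  (l0norm p <= s)%N -> (l0norm b <= s)%N ->
  l1norm (subRn b p) ^+ 2 <= 4 * s%:R * \sum_j tnth (subRn b p) j ^+ 2.
Proof.
move=> p0 b0; set D := subRn b p.
have DE j : tnth D j = tnth b j - tnth p j by rewrite tnth_mktuple.
pose A := [pred j : 'I_k | (tnth p j != 0) || (tnth b j != 0)].
have off j : j \notin A -> tnth D j = 0.
  by rewrite inE negb_or !negbK DE => /andP[/eqP -> /eqP ->]; rewrite subrr.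
have splitA (f : 'I_k -> R) : (forall j, j \notin A -> f j = 0) ->
    \sum_j f j = \sum_(j in A) f j.
  move=> f0; rewrite (bigID (mem A)) /= [X in _ + X]big1 ?addr0//.
have Acard : (#|A| <= s + s)%N.
  apply: leq_trans (leq_add p0 b0); rewrite /l0norm -cardUI.
  apply: leq_trans (leq_addr _ _); apply: subset_leq_card.
  by apply/fintype.subsetP => j; rewrite !inE.
rewrite /l1norm splitA; last by move=> j /off ->; rewrite normr0.
rewrite splitA; last by move=> j /off ->; rewrite expr0n.
apply: (le_trans (sqr_sum_le_card _ _)).
under eq_bigr do rewrite real_normK ?num_real//.
rewrite ler_wpM2r//; first by rewrite sumr_ge0// => j _; exact: sqr_ge0.
rewrite (@le_trans _ _ (s + s)%:R) ?ler_nat// natrD.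
by have := ler0n R s; lra.
Qed.

(** From [q <= 2 sqrt(F) |D|_1] and [|D|_1^2 <= 4 s |D|_2^2 <= 4 s q / C], the
square of [q] is at most [(16 / C) s F q]. *)
Lemma basic_inequality (R : realType) (k s : nat) (C F q : R) (D : k.-tuple R)
    (g : 'I_k -> R) : 0 < C -> 0 <= F -> (forall j, g j ^+ 2 <= F) ->
  C * \sum_j tnth D j ^+ 2 <= q -> q <= 2 * \sum_j tnth D j * g j ->
  l1norm D ^+ 2 <= 4 * s%:R * \sum_j tnth D j ^+ 2 ->
  q <= 16 / C * s%:R * F.
Proof.
move=> C0 F0 gF Cq qg D1.
set n2 := \sum_j _ in Cq D1.
have n20 : 0 <= n2 by rewrite sumr_ge0// => j _; exact: sqr_ge0.
have q0 : 0 <= q by apply: le_trans Cq; rewrite mulr_ge0// ltW.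
have [->|qn0] := eqVneq q 0; first by rewrite !mulr_ge0// invr_ge0 ltW.
have qp : 0 < q by rewrite lt_def qn0.
have h1 : q <= 2 * (Num.sqrt F * l1norm D).
  apply: (le_trans qg); rewrite ler_pM2l// /l1norm mulr_sumr ler_sum// => j _.
  rewrite (le_trans (ler_norm _))// normrM mulrC ler_wpM2r//.
  by rewrite -sqrtr_sqr ler_wsqrtr.
have l10 : 0 <= l1norm D by rewrite sumr_ge0.
have h2 : q ^+ 2 <= 4 * (F * l1norm D ^+ 2).
  have -> : 4 * (F * l1norm D ^+ 2) = (2 * (Num.sqrt F * l1norm D)) ^+ 2.
    by rewrite !exprMn sqr_sqrtr//; ring.
  by rewrite lerXn2r ?nnegrE// mulr_ge0// mulr_ge0// sqrtr_ge0.
have h3 : n2 <= q / C by rewrite ler_pdivlMr// mulrC.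
rewrite -(ler_pM2r qp) -expr2 (le_trans h2)//.
have -> : 16 / C * s%:R * F * q = 4 * (F * (4 * s%:R * (q / C))) by ring.
rewrite ler_pM2l// ler_wpM2l// (le_trans D1)// ler_wpM2l// mulr_ge0//.
Qed.

Definition rowRn (R : realType) k (v : k.-tuple R) : 'rV[R]_k := \row_j tnth v j.

Lemma bilin_rowRn (R : realType) k (M : 'M[R]_k) (u v : k.-tuple R) :
  bilin M (rowRn u) (rowRn v) = \sum_i \sum_j tnth u i * M i j * tnth v j.
Proof.
rewrite bilinE; apply: eq_bigr => i _; apply: eq_bigr => j _.
by rewrite !mxE.
Qed.

(** The difference of the risks at [b = p + D] and at [p] is
[- 2 D . (h - M p) + D^T M D], so that [b] being better than [p] is the
hypothesis [q <= 2 D . g] of [basic_inequality]. *)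
Lemma argmin_excess_risk (R : realType) (k s : nat) (C F : R) (M : 'M[R]_k)
    (h : 'I_k -> R) (b p : k.-tuple R) :
  0 < C -> 0 <= F -> M^T = M -> (forall l, eigenvalue M l -> C <= l) ->
  (forall j, (h j - \sum_l tnth p l * M j l) ^+ 2 <= F) ->
  - 2 * (\sum_j tnth b j * h j) + bilin M (rowRn b) (rowRn b) <=
  - 2 * (\sum_j tnth p j * h j) + bilin M (rowRn p) (rowRn p) ->
  l1norm (subRn b p) ^+ 2 <= 4 * s%:R * \sum_j tnth (subRn b p) j ^+ 2 ->
  bilin M (rowRn (subRn b p)) (rowRn (subRn b p)) <= 16 / C * s%:R * F.
Proof.
move=> C0 F0 MT eig hF bp cone.
set D := subRn b p in cone *.
have DE j : tnth D j = tnth b j - tnth p j by rewrite tnth_mktuple.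
have bE : rowRn b = rowRn p + 1 *: rowRn D.
  by apply/rowP => j; rewrite !mxE DE mul1r addrC subrK.
apply: (basic_inequality (D := D) C0 F0 hF) => //.
  have := eigenvalue_Rayleigh MT eig (rowRn D); rewrite bilin1E.
  by under eq_bigr do rewrite mxE.
move: bp; rewrite bE bilinDZ// expr1n !mul1r => bp.
have e1 : \sum_j tnth b j * h j = \sum_j tnth p j * h j + \sum_j tnth D j * h j.
  by rewrite -big_split; apply: eq_bigr => j _; rewrite /= DE; ring.
have e2 : \sum_j tnth D j * (h j - \sum_l tnth p l * M j l) =
    \sum_j tnth D j * h j - bilin M (rowRn p) (rowRn D).
  rewrite bilin_rowRn exchange_big /= -sumrB; apply: eq_bigr => j _.
  rewrite mulrBr mulr_sumr; congr (_ - _); apply: eq_bigr => l _.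
  have -> : M j l = M l j by rewrite -[in LHS]MT mxE.
  by ring.
by rewrite e2; rewrite e1 in bp; lra.
Qed.

(** * Integrals of bounded functions *)

Lemma integral_cst_probability d (T : measurableType d) (R : realType)
    (P : probability T R) (c : R) : (\int[P]_x c%:E = c%:E)%E.
Proof. by have := expectation_cst P c; rewrite unlock. Qed.

Lemma integrableM_ae_bounded d (T : measurableType d) (R : realType)
    (mu : {measure set T -> \bar R}) (g W : T -> R) (K : R) :
  mu.-integrable setT (EFin \o g) -> measurable_fun setT W ->
  {ae mu, forall x, `|W x| <= K} ->
  mu.-integrable setT (fun x => (g x * W x)%:E).
Proof.
move=> ig mW WK.
have mg : measurable_fun setT g by apply/measurable_EFinP/measurable_int/ig.
have mgW : measurable_fun setT (fun x => g x * W x) by exact: measurable_funM.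
apply/integrableP; split; first exact/measurable_EFinP.
apply: (@le_lt_trans _ _ (\int[mu]_x (`|K|%:E * `|(g x)%:E|))%E).
  apply: ae_ge0_le_integral => //.
  - by apply: measurableT_comp => //; exact/measurable_EFinP.
  - apply: emeasurable_funM => //; apply: measurableT_comp => //.
    exact/measurable_EFinP.
  - move: WK; apply: filterS => x WK _.
    rewrite /= lee_fin normrM mulrC ler_wpM2r// (le_trans WK)// ler_norm//.
rewrite ge0_integralZl//; last first.
  by apply: measurableT_comp => //; exact/measurable_EFinP.
rewrite lte_mul_pinfty//.
by move/integrableP : ig => [].
Qed.

Lemma integrable_ae_bounded d (T : measurableType d) (R : realType)
    (mu : {finite_measure set T -> \bar R}) (W : T -> R) (K : R) :
  measurable_fun setT W -> {ae mu, forall x, `|W x| <= K} ->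
  mu.-integrable setT (EFin \o W).
Proof.
move=> mW WK.
have := @integrableM_ae_bounded _ _ _ mu (cst 1) W K.
move=> /(_ _ mW WK); rewrite (_ : (fun x => _) = EFin \o W).
  by apply; exact: finite_measure_integrable_cst.
by apply/funext => x /=; rewrite mul1r.
Qed.

Lemma integral_ae_bounded_le d (T : measurableType d) (R : realType)
    (mu : probability T R) (W : T -> R) (K : R) :
  measurable_fun setT W -> {ae mu, forall x, `|W x| <= K} ->
  `|\int[mu]_x W x| <= K.
Proof.
move=> mW WK.
have iW := integrable_ae_bounded mW WK.
have fW : (\int[mu]_x (W x)%:E)%E \is a fin_num by exact: integrable_fin_num.
have K0 : 0 <= K.
  rewrite leNgt; apply/negP => K0.
  have : mu setT = 0%E.
    apply: (@measure_negligible _ _ _ mu setT) => //.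
    by apply: negligibleS WK => x _ /= /(le_trans (normr_ge0 _)); rewrite leNgt K0.
  by rewrite probability_setT => /eqP; rewrite eqe oner_eq0.
rewrite -lee_fin /Rintegral -abse_EFin fineK//.
have mWE : measurable_fun setT (EFin \o W) by exact/measurable_EFinP.
apply: (le_trans (le_abse_integral _ _ mWE)) => //.
rewrite -[leRHS]mule1 -(@probability_setT _ _ _ mu) -(integral_cst mu measurableT).
apply: ae_ge0_le_integral => //.
- exact: measurableT_comp.
- by move: WK; apply: filterS => x WK _; rewrite /= lee_fin.
Qed.

(** An infinite integral of a positive or negative part makes the whole integral
infinite, with the convention [+oo - +oo = -oo]. *)
Lemma fin_num_integrable d (T : measurableType d) (R : realType)
    (mu : {measure set T -> \bar R}) (f : T -> \bar R) :
  measurable_fun setT f -> (\int[mu]_x f x)%E \is a fin_num ->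
  mu.-integrable setT f.
Proof.
move=> mf; rewrite integralE fin_numB => /andP[fp fn].
apply/integrableP; split => //.
have -> : (fun x => `|f x|)%E = (f^\+ \+ f^\-)%E by rewrite -fune_abse.
rewrite ge0_integralD//.
- rewrite -ge0_fin_numE; first by rewrite fin_numD fp fn.
  by apply: adde_ge0; exact: integral_ge0.
- exact: measurable_funepos.
- exact: measurable_funeneg.
Qed.

Lemma weighted_Rintegral_bound d (T : measurableType d) (R : realType)
    (nu : {measure set T -> \bar R}) (S : set T) (f h : T -> R) (B K : R) :
  measurable S -> measurable_fun setT f -> (forall a, 0 <= f a) ->
  (\int[nu]_(a in S) (f a)%:E <= B%:E)%E ->
  measurable_fun setT h -> 0 <= K -> (forall a, S a -> `|h a| <= K) ->
  nu.-integrable S (fun a => (h a * f a)%:E) /\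
  (\int[nu]_(a in S) `|(h a * f a)%:E| <= (K * B)%:E)%E.
Proof.
move=> mS mf f0 fB mh K0 hK.
have mhf : measurable_fun S (fun a => (h a * f a)%:E).
  by apply/measurable_funTS/measurable_EFinP; exact: measurable_funM.
have le : (\int[nu]_(a in S) `|(h a * f a)%:E| <= (K * B)%:E)%E.
  apply: (@le_trans _ _ (\int[nu]_(a in S) (K%:E * (f a)%:E))%E).
    apply: ge0_le_integral => //.
    - exact: measurableT_comp.
    - apply: emeasurable_funM => //.
      by apply/measurable_funTS/measurable_EFinP.
    - by move=> a Sa; rewrite lee_fin normrM (ger0_norm (f0 a)) ler_wpM2r// hK.
  rewrite ge0_integralZl//; last 2 first.
  - by apply/measurable_funTS/measurable_EFinP.
  - by move=> a _; rewrite lee_fin.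
  by rewrite EFinM lee_wpmul2l.
by split=> //; apply/integrableP; split=> //; rewrite (le_lt_trans le)// ltry.
Qed.

Lemma Rintegral_norm_le d (T : measurableType d) (R : realType)
    (nu : {measure set T -> \bar R}) (S : set T) (g : T -> R) (K : R) :
  measurable S -> nu.-integrable S (EFin \o g) ->
  (\int[nu]_(a in S) `|(g a)%:E| <= K%:E)%E -> `|\int[nu]_(a in S) g a| <= K.
Proof.
move=> mS ig gK; rewrite -lee_fin /Rintegral -abse_EFin fineK.
  apply: le_trans gK; apply: le_abse_integral => //.
  exact: measurable_int ig.
exact: integrable_fin_num.
Qed.

Lemma Rintegral_lin d (T : measurableType d) (R : realType)
    (nu : {measure set T -> \bar R}) (S : set T) (I : finType)
    (g : I -> T -> R) (c : I -> R) :
  measurable S -> (forall i, nu.-integrable S (EFin \o g i)) ->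
  nu.-integrable S (fun a => (\sum_i c i * g i a)%:E) /\
  \int[nu]_(a in S) (\sum_i c i * g i a) = \sum_i c i * \int[nu]_(a in S) g i a.
Proof.
move=> mS ig; elim: (index_enum I) => [|i s [IH1 IH2]].
  split.
    under eq_fun do rewrite big_nil; exact: integrable0.
  under eq_Rintegral do rewrite big_nil.
  by rewrite big_nil /Rintegral integral0.
have igi : nu.-integrable S (EFin \o (fun a => c i * g i a)).
  exact: (integrableZl mS (c i) (ig i)).
split.
  under eq_fun do rewrite big_cons EFinD; exact: integrableD.
under eq_Rintegral do rewrite big_cons.
by rewrite big_cons RintegralD// IH2 RintegralZl.
Qed.

(** Hoelder's inequality with exponents 2 and 2 bounds the integral of [|u v|], hence
both claims. *)
Lemma L2_integral_mul (R : realType) d (T : measurableType d)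
    (Q : probability T R) (u v : T -> R) (a b : R) :
  measurable_fun setT u -> measurable_fun setT v ->
  (Lnorm Q 2%:E (EFin \o u) <= a%:E)%E -> (Lnorm Q 2%:E (EFin \o v) <= b%:E)%E ->
  Q.-integrable setT (fun z => (u z * v z)%:E) /\
  (`|\int[Q]_z (u z * v z)%:E| <= (a * b)%:E)%E.
Proof.
move=> mu mv ua vb.
have muv : measurable_fun setT (fun z => (u z * v z)%:E).
  by apply/measurable_EFinP; exact: measurable_funM.
have le : (\int[Q]_z `|(u z * v z)%:E| <= (a * b)%:E)%E.
  have := @hoelder _ _ _ Q u v 2 2 mu mv; rewrite Lnorm1 => h.
  rewrite (le_trans (h _ _ _))// ?ltr0n//; first lra.
  by rewrite EFinM; apply: lee_pmul => //; exact: Lnorm_ge0.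
split.
  by apply/integrableP; split=> //; rewrite (le_lt_trans le)// ltry.
by rewrite (le_trans (le_abse_integral _ _ muv)).
Qed.

(** The identity [x^-1 = x * (|x|^-1)^2] also holds at [0] and reduces the claim to
a power of a nonnegative number. *)
Lemma measurable_inv (R : realType) : measurable_fun setT (fun x : R => x^-1).
Proof.
have -> : (fun x : R => x^-1) = (fun x => x * (`|x| `^ (-1)) ^+ 2).
  apply/funext => x; have [->|x0] := eqVneq x 0; first by rewrite invr0 mul0r.
  rewrite powR_inv1// exprVn real_normK ?num_real// expr2 invfM mulrA divff//.
  by rewrite mul1r.
apply: measurable_funM => //; apply: measurable_funX.
by apply: (measurableT_comp (measurable_powR (-1))); exact: normr_measurable.
Qed.

Lemma measurable_section1 d1 d2 (X : measurableType d1) (Y : measurableType d2)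
    (R : realType) (g : X -> Y -> R) x :
  measurable_fun setT (fun u : X * Y => g u.1 u.2) ->
  measurable_fun setT (g x).
Proof. by move=> mg; exact: (measurableT_comp mg (measurable_pair1 x)). Qed.

(** Tonelli applied to the positive and negative parts; where their integrals are
infinite, [fine] yields a default value, which keeps the map measurable. *)
Lemma measurable_Rintegral_param d1 d2 (T1 : measurableType d1)
    (T2 : measurableType d2) (R : realType)
    (nu : {sigma_finite_measure set T2 -> \bar R}) (A : set T2)
    (g : T1 * T2 -> R) :
  measurable A -> measurable_fun setT g ->
  measurable_fun setT (fun x => \int[nu]_(y in A) g (x, y)).
Proof.
move=> mA mg; apply: measurableT_comp => //.
pose G : T1 * T2 -> \bar R := (EFin \o g) \_ (setT `*` A).
have mG : measurable_fun setT G.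
  apply/(measurable_restrictT _ _).1; first exact: measurableX.
  by apply/measurable_funTS/measurable_EFinP.
rewrite (_ : (fun x => _) = (fun x => fubini_F nu (G^\+)%E x - fubini_F nu (G^\-)%E x)%E).
  apply: emeasurable_funB.
  - apply: measurable_fun_fubini_tonelli_F; first exact: measurable_funepos.
    by move=> x; exact: funepos_ge0.
  - apply: measurable_fun_fubini_tonelli_F; first exact: measurable_funeneg.
    by move=> x; exact: funeneg_ge0.
apply/funext => x; rewrite integral_mkcond.
rewrite (_ : _ \_ A = G \o pair x); last first.
  apply/funext => y; rewrite /G /= !patchE /=; have [yA|yA] := boolP (y \in A).
    by rewrite mem_set//; split=> //; exact: set_mem.
  by rewrite memNset// => -[_ /= yA']; move/negP : yA; apply; exact: mem_set.
by rewrite integralE funepos_comp funeneg_comp.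
Qed.

(** * Transfer of integrals between weighted measures *)

Section density_measure.
Import HBNNSimple.

(** The integral formula holds for indicators by definition and passes to simple
functions by linearity and to nonnegative functions by monotone convergence. *)
Lemma density_measure d (T : measurableType d) (R : realType)
    (mu : {measure set T -> \bar R}) (w : T -> R) :
  measurable_fun setT w -> (forall x, 0 <= w x) ->
  exists nu : {measure set T -> \bar R},
    (forall S, measurable S -> nu S = (\int[mu]_(x in S) (w x)%:E)%E) /\
    forall g : T -> \bar R, measurable_fun setT g -> (forall x, 0 <= g x)%E ->
      (\int[nu]_x g x = \int[mu]_x (g x * (w x)%:E))%E.
Proof.
move=> mw w0; pose nu0 (S : set T) := (\int[mu]_(x in S) (w x)%:E)%E.
have mwE D : measurable_fun D (EFin \o w).
  by apply/measurable_funTS/measurable_EFinP.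
have w0E x : (0 <= (w x)%:E)%E by rewrite lee_fin.
have nu00 : nu0 set0 = 0%E by rewrite /nu0 integral_set0.
have nu0ge S : (0 <= nu0 S)%E by exact: integral_ge0.
have nu0s : semi_sigma_additive nu0.
  move=> F mF tF mUF; rewrite /nu0 ge0_integral_bigcup//.
  by apply: is_cvg_nneseries => n _ _; exact: nu0ge.
pose nu : {measure set T -> \bar R} :=
  HB.pack nu0 (isMeasure.Build _ _ _ nu0 nu00 nu0ge nu0s).
exists nu; split=> // g mg g0.
pose h := nnsfun_approx measurableT mg.
have mh n D : measurable_fun D (EFin \o h n).
  by apply/measurable_funTS/measurable_EFinP/measurable_funP.
have gE x : g x = limn (fun n => (h n x)%:E).
  by apply/esym/cvg_lim => //; exact: cvg_nnsfun_approx.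
have -> : (\int[nu]_x g x = limn (fun n => \int[nu]_x (h n x)%:E))%E.
  under eq_integral do rewrite gE.
  apply: monotone_convergence => //.
  - by move=> n; exact: mh.
  - by move=> n x _; rewrite lee_fin.
  - by move=> x _ a b ab; rewrite lee_fin; exact/lefP/nd_nnsfun_approx.
have -> : (\int[mu]_x (g x * (w x)%:E) =
    limn (fun n => \int[mu]_x ((h n x)%:E * (w x)%:E)))%E.
  rewrite -monotone_convergence//.
  - apply: eq_integral => x _; apply/esym/cvg_lim => //; apply: cvgeZr => //.
    exact: cvg_nnsfun_approx.
  - by move=> n; apply: emeasurable_funM => //; exact: mh.
  - by move=> n x _; rewrite mule_ge0// lee_fin.
  - move=> x _ a b ab; rewrite lee_wpmul2r// lee_fin; exact/lefP/nd_nnsfun_approx.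
congr (limn _); apply/funext => n.
rewrite integralT_nnsfun sintegralE.
have ind x : ((h n x)%:E * (w x)%:E =
    \sum_(r \in range (h n)) ((r * \1_(h n @^-1` [set r]) x)%:E * (w x)%:E))%E.
  rewrite -ge0_mule_fsuml; last by move=> y; exact: nnfun_muleindic_ge0.
  by rewrite fsumEFin// -fimfunE.
under eq_integral do rewrite ind.
rewrite ge0_integral_fsum//; last 2 first.
  - move=> r; apply: emeasurable_funM => //.
    by apply/measurable_EFinP; exact: measurable_funM.
  - by move=> r x _; rewrite mule_ge0// nnfun_muleindic_ge0.
apply: eq_fsbigr => r.
rewrite inE => -[y _ hy].
have r0 : 0 <= r by rewrite -hy.
under [RHS]eq_integral do rewrite EFinM -muleA.
rewrite ge0_integralZl//; last 2 first.
- by apply: emeasurable_funM => //; exact/measurable_EFinP.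
- by move=> x _; rewrite mule_ge0// lee_fin.
congr (_ * _)%E; rewrite /nu /= /nu0 integral_mkcond.
by apply: eq_integral => x _; rewrite epatch_indic muleC.
Qed.

End density_measure.

(** Extends an equality known on sets to nonnegative functions: both sides are
integrals of [g] for the images of the weighted measures, which coincide.  It is
used for the regression function (weights: the two parts of the residual), for
the conditional density, and for one factor of a product of independent
variables. *)
Lemma eq_weighted_integral d1 d2 d3 (T1 : measurableType d1)
    (T2 : measurableType d2) (F : measurableType d3) (R : realType)
    (mu1 : {measure set T1 -> \bar R}) (mu2 : {measure set T2 -> \bar R})
    (phi1 : T1 -> F) (phi2 : T2 -> F) (w1 : T1 -> R) (w2 : T2 -> R) :
  measurable_fun setT phi1 -> measurable_fun setT phi2 ->
  measurable_fun setT w1 -> measurable_fun setT w2 ->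
  (forall x, 0 <= w1 x) -> (forall x, 0 <= w2 x) ->
  (forall S, measurable S -> (\int[mu1]_(x in phi1 @^-1` S) (w1 x)%:E =
                              \int[mu2]_(x in phi2 @^-1` S) (w2 x)%:E)%E) ->
  forall g : F -> \bar R, measurable_fun setT g -> (forall x, 0 <= g x)%E ->
    (\int[mu1]_x (g (phi1 x) * (w1 x)%:E) =
     \int[mu2]_x (g (phi2 x) * (w2 x)%:E))%E.
Proof.
move=> mp1 mp2 mw1 mw2 w10 w20 H g mg g0.
have [nu1 [nu1E <-]] := density_measure mu1 mw1 w10; last 2 first.
- exact: measurableT_comp.
- by move=> x.
have [nu2 [nu2E <-]] := density_measure mu2 mw2 w20; last 2 first.
- exact: measurableT_comp.
- by move=> x.
have push d (T : measurableType d) (nu : {measure set T -> \bar R}) phi :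
    measurable_fun setT phi ->
    (\int[nu]_x g (phi x) = \int[pushforward nu phi]_y g y)%E.
  by move=> mphi; rewrite ge0_integral_pushforward// preimage_setT.
rewrite (push _ _ nu1 phi1)// (push _ _ nu2 phi2)//; apply: eq_measure_integral => S mS _.
have mpre d (T : measurableType d) (phi : T -> F) :
    measurable_fun setT phi -> measurable (phi @^-1` S).
  by move=> mphi; rewrite -[_ @^-1` _]setTI; exact: mphi.
change (nu1 (phi1 @^-1` S) = nu2 (phi2 @^-1` S)).
rewrite nu1E; last exact: mpre.
by rewrite nu2E; [exact: H|exact: mpre].
Qed.

Lemma measure_unique_prod d1 d2 (T1 : measurableType d1)
    (T2 : measurableType d2) (R : realType)
    (m1 m2 : {measure set (T1 * T2) -> \bar R}) :
  (m1 setT < +oo)%E ->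
  (forall A B, measurable A -> measurable B -> m1 (A `*` B) = m2 (A `*` B)) ->
  forall S, measurable S -> m1 S = m2 S.
Proof.
move=> m1oo H S mS.
apply: (@measure_unique _ _ _ [set A `*` B | A in measurable & B in measurable]
   (fun=> setT)) => //.
- exact: measurable_prod_measurableType.
- move=> _ _ [A mA [B mB <-]] [A' mA' [B' mB' <-]].
  rewrite -setXI; exists (A `&` A'); first exact: measurableI.
  by exists (B `&` B') => //; exact: measurableI.
- by move=> _; exists setT => //; exists setT => //; rewrite setXTT.
- by apply/seteqP; split=> // x _; exists 0%N.
- by move=> _ [A mA [B mB <-]]; exact: H.
Qed.

(** * Independent samples *)

(** The product rule gives the case where every factor is an indicator.  The
indicators are replaced by functions one index at a time: the other factors
being fixed, both sides are integrals of the factor against measures that agree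
on sets. *)
Lemma iid_integral_prod dO d (T : measurableType dO) (E : measurableType d)
    (R : realType) (P : probability T R) (n : nat)
    (D : {RV P >-> n.-tuple E}) (Q : probability E R) (f : 'I_n -> E -> R) :
  iid_sample D Q ->
  (forall i, measurable_fun setT (f i)) -> (forall i z, 0 <= f i z) ->
  (forall i, (\int[Q]_z (f i z)%:E < +oo)%E) ->
  (\int[P]_w (\prod_(i < n) f i (tnth (D w) i))%:E =
   \prod_(i < n) \int[Q]_z (f i z)%:E)%E.
Proof.
move=> [law indep] mf f0 foo.
have mD i : measurable_fun setT (fun w => tnth (D w) i).
  by apply: (measurableT_comp (measurable_tnth i)).
have mDS i S : measurable S -> measurable [set w | S (tnth (D w) i)].
  by move=> mS; rewrite -[X in measurable X]setTI; exact: mD.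
pose indicated j (g : 'I_n -> E -> R) :=
  forall i : 'I_n, (j <= i)%N -> exists2 S, measurable S & g i = \1_S.
(* Factors of index at least [j] are indicators; [j = n] is the claim. *)
suff {f mf f0 foo} H j : (j <= n)%N -> forall f : 'I_n -> E -> R,
    indicated j f ->
    (forall i, measurable_fun setT (f i)) -> (forall i z, 0 <= f i z) ->
    (forall i, (\int[Q]_z (f i z)%:E < +oo)%E) ->
    (\int[P]_w (\prod_(i < n) f i (tnth (D w) i))%:E =
     \prod_(i < n) \int[Q]_z (f i z)%:E)%E.
  by apply: (H n) => // i; rewrite leqNgt ltn_ord.
elim: j => [_|j IH jn] f indf mf f0 foo.
  have /choice[S HS] : forall i, exists S, measurable S /\ f i = \1_S.
    by move=> i; have [S mS fS] := indf i (leq0n i); exists S.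
  have mS i : measurable (S i) by have [] := HS i.
  have fS i : f i = \1_(S i) by have [] := HS i.
  pose A := [set w | forall i : 'I_n, S i (tnth (D w) i)].
  have AE : A = \bigcap_(i in [set: 'I_n]) [set w | S i (tnth (D w) i)].
    by apply/seteqP; split=> [w Aw i _|w Aw i]; exact: Aw.
  have mA : measurable A.
    by rewrite AE; apply: fin_bigcap_measurable => // i _; exact: mDS.
  transitivity (\int[P]_w (\1_A w)%:E)%E.
    apply: eq_integral => w _; congr EFin.
    rewrite [RHS]indicE; have [/set_mem wA|wA] := boolP (w \in A).
      by rewrite big1// => i _; rewrite fS indicE mem_set//; exact: wA.
    have : exists i, ~ S i (tnth (D w) i).
      apply/existsNP => h; move/negP: wA; apply; exact: mem_set.
    move=> [i Si]; rewrite (bigD1 i)//= fS indicE memNset//.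
    by rewrite mul0r.
  rewrite integral_indic// setIT [LHS](indep S mS); apply: eq_bigr => i _.
  by rewrite law// fS integral_indic// setIT.
pose j0 : 'I_n := Ordinal jn.
pose G w := \prod_(i < n | i != j0) f i (tnth (D w) i).
have mfD i : measurable_fun setT (fun w => f i (tnth (D w) i)).
  exact: measurableT_comp (mf i) (mD i).
have mG : measurable_fun setT G.
  rewrite /G; under eq_fun do rewrite big_mkcond.
  by apply: measurable_prod => i _; case: (i != j0).
have G0 w : 0 <= G w by rewrite prodr_ge0.
have ffin i : (\int[Q]_z (f i z)%:E)%E \is a fin_num.
  by rewrite ge0_fin_numE// integral_ge0// => x _; rewrite lee_fin.
pose c := \prod_(i < n | i != j0) fine (\int[Q]_z (f i z)%:E)%E.
have c0 : 0 <= c.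
  rewrite prodr_ge0// => i _; rewrite fine_ge0// integral_ge0// => x _.
  by rewrite lee_fin.
have cE : (\prod_(i < n | i != j0) \int[Q]_z (f i z)%:E = c%:E)%E.
  by rewrite -prodEFin; apply: eq_bigr => i _; rewrite fineK.
rewrite (bigD1 j0)//= cE.
transitivity (\int[P]_w ((f j0 (tnth (D w) j0))%:E * (G w)%:E))%E.
  by apply: eq_integral => w _; rewrite -EFinM (bigD1 j0).
rewrite (@eq_weighted_integral _ _ _ _ _ _ _ P Q (fun w => tnth (D w) j0) id G
  (cst c) _ _ _ _ _ _ _ (fun z => (f j0 z)%:E))//=.
- rewrite muleC -ge0_integralZl//=.
  + by apply: eq_integral => z _; rewrite muleC.
  + exact/measurable_EFinP.
  + by move=> z _; rewrite lee_fin.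
- move=> S mS.
  rewrite preimage_id integral_cst// -cE.
  pose f' i := if i == j0 then \1_S : E -> R else f i.
  have f'S : f' j0 = \1_S by rewrite /f' eqxx.
  have f'f i : i != j0 -> f' i = f i by rewrite /f'; case: eqVneq.
  have := IH (ltnW jn) f'.
  rewrite (bigD1 j0)//= f'S integral_indic// setIT.
  under eq_bigr => i ij do rewrite f'f//.
  rewrite muleC => <-.
  + rewrite integral_mkcond; apply: eq_integral => w _.
    rewrite epatch_indic -EFinM (bigD1 j0)//= f'S; congr EFin.
    rewrite mulrC; congr (_ * _).
    by apply: eq_bigr => i ij; rewrite f'f.
  + move=> i; rewrite leq_eqVlt => /orP[/eqP ji|ji].
      by exists S => //; rewrite (_ : i = j0)//; exact: val_inj.
    rewrite f'f; first exact: indf.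
    by apply: contraTneq ji => ->; rewrite ltnn.
  + move=> i; have [->|ij] := eqVneq i j0; last by rewrite f'f.
    by rewrite f'S; exact: measurable_indic.
  + by move=> i z; have [->|ij] := eqVneq i j0; [rewrite f'S|rewrite f'f].
  + move=> i; have [->|ij] := eqVneq i j0; last by rewrite f'f.
    rewrite f'S integral_indic// setIT (le_lt_trans (probability_le1 _ _))//.
    exact: ltry.
- exact/measurable_EFinP.
- by move=> z; rewrite lee_fin.
Qed.

(** The joint law is the product of the marginal laws; Tonelli then separates the
two variables. *)
Lemma indep_integral dO d1 d2 (T : measurableType dO) (E1 : measurableType d1)
    (E2 : measurableType d2) (R : realType) (P : probability T R)
    (U : {RV P >-> E1}) (V : {RV P >-> E2}) (F : E1 * E2 -> \bar R) :
  indep_rv U V -> measurable_fun setT F -> (forall u, 0 <= F u)%E ->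
  (\int[P]_w F (U w, V w) = \int[P]_w \int[P]_w' F (U w, V w'))%E.
Proof.
move=> UV mF F0.
have mU : measurable_fun setT U by [].
have mV : measurable_fun setT V by [].
have mUV : measurable_fun setT (fun w => (U w, V w)).
  exact: measurable_fun_pair.
transitivity (\int[pushforward P (fun w => (U w, V w))]_u F u)%E.
  by rewrite ge0_integral_pushforward// preimage_setT.
transitivity (\int[distribution P U \x distribution P V]_u F u)%E.
  apply: eq_measure_integral => S mS _; apply/esym.
  by apply: product_measure_unique => // A B mA mB; exact: UV.
rewrite fubini_tonelli1// ge0_integral_distribution//=; last 2 first.
- exact: measurable_fun_fubini_tonelli_F.
- by move=> u; apply: integral_ge0.
apply: eq_integral => w _ /=; rewrite /fubini_F ge0_integral_distribution//.
by apply: measurableT_comp => //; exact: measurable_pair1.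
Qed.

(** The bound is required for almost every [w], and not for almost every value of
[U]: the exceptional set need not be the preimage of a null set. *)
Lemma indep_integral_le dO d1 d2 (T : measurableType dO) (E1 : measurableType d1)
    (E2 : measurableType d2) (R : realType) (P : probability T R)
    (U : {RV P >-> E1}) (V : {RV P >-> E2}) (F : E1 * E2 -> \bar R) (K : R) :
  indep_rv U V -> measurable_fun setT F -> (forall u, 0 <= F u)%E -> 0 <= K ->
  {ae P, forall w, (\int[P]_w' F (U w, V w') <= K%:E)%E} ->
  (\int[P]_w F (U w, V w) <= K%:E)%E.
Proof.
move=> UV mF F0 K0 FK; rewrite (indep_integral UV mF F0).
rewrite -(integral_cst_probability P K).
have mUV2 : measurable_fun setT (fun v : T * T => (U v.1, V v.2)).
  by apply: measurable_fun_pair; exact: measurableT_comp.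
have mFUV := measurableT_comp mF mUV2.
apply: ae_ge0_le_integral => //.
- by move=> w _; exact: integral_ge0.
- exact: (measurable_fun_fubini_tonelli_F (m2 := P) _ mFUV (fun=> F0 _)).
- by apply: filterS FK.
Qed.

Lemma indep_ae dO d1 d2 (T : measurableType dO) (E1 : measurableType d1)
    (E2 : measurableType d2) (R : realType) (P : probability T R)
    (U : {RV P >-> E1}) (V : {RV P >-> E2}) (N : set (E1 * E2)) :
  indep_rv U V -> measurable N ->
  {ae P, forall w, P [set w' | N (U w, V w')] = 0%E} ->
  {ae P, forall w, ~ N (U w, V w)}.
Proof.
move=> UV mN N0.
have mpre (g : T -> E1 * E2) : measurable_fun setT g -> measurable [set w | N (g w)].
  by move=> mg; rewrite -[X in measurable X]setTI; exact: mg.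
have mUVN : measurable [set w | N (U w, V w)].
  by apply: mpre; exact: measurable_fun_pair.
have mUN u : measurable [set w' | N (u, V w')].
  by apply: mpre; exact: measurable_fun_pair.
have m1N : measurable_fun setT (fun u => (\1_N u)%:E : \bar R).
  by apply/measurable_EFinP; exact: measurable_indic.
have N1 u : (0 <= (\1_N u)%:E :> \bar R)%E by rewrite lee_fin.
have H : (\int[P]_w (\1_N (U w, V w))%:E <= 0%:E)%E.
  apply: (indep_integral_le UV m1N N1) => //.
  apply: filterS N0 => w N0.
  have -> : (fun w' => (\1_N (U w, V w'))%:E) =
      (fun w' => (\1_[set w' | N (U w, V w')] w')%:E) :> (T -> \bar R) by [].
  apply: (@le_trans _ _ (P [set w' | N (U w, V w')])); last by rewrite N0.
  by rewrite integral_indic// setIT.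
exists [set w | N (U w, V w)]; split => //; last by move=> w /= /contrapT.
apply/eqP; rewrite eq_le measure_ge0 andbT; apply: le_trans H.
have -> : (fun w => (\1_N (U w, V w))%:E) =
    (fun w => (\1_[set w | N (U w, V w)] w)%:E) :> (T -> \bar R) by [].
by rewrite integral_indic// setIT.
Qed.

(** Integrate [expR x <= x + expR (2 x^2)] at [x = t V]. *)
Lemma mgf_bounded (R : realType) d (E : measurableType d)
    (Q : probability E R) (V : E -> R) (c t : R) :
  measurable_fun setT V -> {ae Q, forall z, `|V z| <= c} ->
  \int[Q]_z V z = 0 ->
  (\int[Q]_z (expR (t * V z))%:E <= (expR (2 * (t * c) ^+ 2))%:E)%E.
Proof.
move=> mV Vc V0.
have iV := integrable_ae_bounded mV Vc.
have mtV : measurable_fun setT (fun z => t * V z) by exact: measurable_funM.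
have me : measurable_fun setT (fun z => expR (t * V z)).
  exact: (measurableT_comp (@measurable_expR R)).
have ie : Q.-integrable setT (EFin \o (fun z => expR (t * V z))).
  apply: (@integrable_ae_bounded _ _ _ Q _ (expR (`|t| * c))) => //.
  apply: filterS Vc => z Vz; rewrite ger0_norm ?expR_ge0// ler_expR.
  by rewrite (le_trans (ler_norm _))// normrM ler_wpM2l.
have itV := integrableZl measurableT t iV.
have V0E : (\int[Q]_z (V z)%:E = 0)%E.
  rewrite -[LHS]fineK; last exact: integrable_fin_num.
  by congr EFin; exact: V0.
have -> : (\int[Q]_z (expR (t * V z))%:E =
    \int[Q]_z ((expR (t * V z))%:E - t%:E * (V z)%:E))%E.
  by rewrite integralB// integralZl// V0E mule0 sube0.
rewrite -(integral_cst_probability Q (expR _)).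
have ge_x (x : R) : x <= expR x.
  by rewrite (le_trans _ (expR_ge1Dx x))// lerDr.
apply: ae_ge0_le_integral => //.
- by move=> z _; rewrite -EFinM -EFinB lee_fin subr_ge0.
- exact: (measurable_int Q (integrableB measurableT ie itV)).
- apply: filterS Vc => z Vz _; rewrite -EFinM -EFinB lee_fin lerBlDl.
  apply: (le_trans (expR_le_add_expR_sq _)); rewrite lerD2l ler_expR ler_pM2l//.
  rewrite -[leLHS]real_normK ?num_real// -[leRHS]real_normK ?num_real//.
  rewrite lerXn2r ?nnegrE// !normrM ler_wpM2l//.
  by rewrite (le_trans Vz)// ler_norm.
Qed.

Lemma iid_mean_mgf (R : realType) dO d (T : measurableType dO)
    (E : measurableType d) (P : probability T R) (n : nat)
    (D : {RV P >-> n.-tuple E}) (Q : probability E R) (V : E -> R) (c t : R) :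
  (0 < n)%N -> iid_sample D Q ->
  measurable_fun setT V -> {ae Q, forall z, `|V z| <= c} ->
  \int[Q]_z V z = 0 ->
  (\int[P]_w (expR (t * (n%:R^-1 * \sum_(i < n) V (tnth (D w) i))))%:E <=
   (expR (2 * (t * c) ^+ 2 / n%:R))%:E)%E.
Proof.
move=> n0 iid mV Vc V0.
have n0R : n%:R != 0 :> R by rewrite pnatr_eq0 -lt0n.
have mgf := mgf_bounded (t / n%:R) mV Vc V0.
pose f (i : 'I_n) z := expR (t / n%:R * V z).
have mf i : measurable_fun setT (f i).
  by apply: (measurableT_comp (@measurable_expR R)); exact: measurable_funM.
have -> : (\int[P]_w (expR (t * (n%:R^-1 * \sum_(i < n) V (tnth (D w) i))))%:E =
    \int[P]_w (\prod_(i < n) f i (tnth (D w) i))%:E)%E.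
  apply: eq_integral => w _; congr EFin; rewrite /f -expR_sum -mulr_sumr.
  by rewrite mulrA.
have ffin i : (\int[Q]_z (f i z)%:E < +oo)%E.
  by rewrite (le_lt_trans mgf)// ltry.
rewrite (iid_integral_prod iid mf (fun i z => expR_ge0 _) ffin).
pose I0 := fine (\int[Q]_z (expR (t / n%:R * V z))%:E)%E.
have I0E : (\int[Q]_z (expR (t / n%:R * V z))%:E = I0%:E)%E.
  rewrite fineK// ge0_fin_numE; first by rewrite (le_lt_trans mgf)// ltry.
  by apply: integral_ge0 => z _; rewrite lee_fin expR_ge0.
under eq_bigr do rewrite I0E.
rewrite prodEFin lee_fin prodr_const card_ord.
have I00 : 0 <= I0.
  by rewrite -lee_fin -I0E; apply: integral_ge0 => z _; rewrite lee_fin expR_ge0.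
apply: (@le_trans _ _ (expR (2 * (t / n%:R * c) ^+ 2) ^+ n)).
  by rewrite lerXn2r ?nnegrE ?expR_ge0// -lee_fin -I0E.
by rewrite -expRM_natl ler_expR le_eqVlt; apply/orP; left; apply/eqP; field.
Qed.

(** * The coordinates of an observation and the support of the treatment *)

Lemma measurable_obsX (R : realType) (d k : nat) :
  measurable_fun setT (@obsX R d k).
Proof. exact: (measurableT_comp measurable_fst measurable_fst). Qed.

Lemma measurable_obsA (R : realType) (d k : nat) :
  measurable_fun setT (@obsA R d k).
Proof. exact: (measurableT_comp measurable_snd measurable_fst). Qed.

Lemma measurable_obsY (R : realType) (d k : nat) :
  measurable_fun setT (@obsY R d k).
Proof. exact: measurable_snd. Qed.

Lemma measurable_obsXA (R : realType) (d k : nat) :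
  measurable_fun setT (fun z : obs R d k => (obsX z, obsA z)).
Proof.
by apply: measurable_fun_pair; [exact: measurable_obsX|exact: measurable_obsA].
Qed.

Lemma measurable_obsX_pair (R : realType) (d k : nat) :
  measurable_fun setT (fun u : obs R d k * k.-tuple R => (obsX u.1, u.2)).
Proof.
apply: measurable_fun_pair => //.
exact: (measurableT_comp (@measurable_obsX R d k)).
Qed.

Lemma measurable_section2 (R : realType) (d k : nat)
    (g : d.-tuple R -> k.-tuple R -> R) a :
  measurable_fun setT (fun u : d.-tuple R * k.-tuple R => g u.1 u.2) ->
  measurable_fun setT (fun z : obs R d k => g (obsX z) a).
Proof.
move=> mg; have h := measurableT_comp mg (measurable_pair2 a).
exact: (measurableT_comp h (@measurable_obsX R d k)).
Qed.

Lemma dotRnC (R : realType) (k : nat) (u v : k.-tuple R) :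
  dotRn u v = dotRn v u.
Proof. by apply: eq_bigr => j _; rewrite mulrC. Qed.

Lemma measurable_dotRn (R : realType) (k : nat) (v : k.-tuple R) :
  measurable_fun setT (fun a => dotRn a v).
Proof.
apply: measurable_sum => j; apply: measurable_funM => //; exact: measurable_tnth.
Qed.

Definition open_cube (R : realType) k (c : 'I_k -> R) (r : R) : set (k.-tuple R) :=
  [set a | forall j, `|tnth a j - c j| < r].

Lemma measurable_open_cube (R : realType) k (c : 'I_k -> R) r :
  measurable (open_cube c r).
Proof.
have -> : open_cube c r =
    \bigcap_(j in [set: 'I_k]) (fun a => `|tnth a j - c j|) @^-1` `]-oo, r[.
  apply/seteqP; split=> [a ca j _ /=|a ca j]; first by rewrite in_itv/= ca.
  by have := ca j I; rewrite /= in_itv.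
apply: fin_bigcap_measurable => // j _.
rewrite -[X in measurable X]setTI.
suff : measurable_fun setT (fun a : k.-tuple R => `|tnth a j - c j|) by apply.
apply: measurableT_comp => //; apply: measurable_funB => //.
exact: measurable_tnth.
Qed.

Section support.
Context {R : realType} {d k : nat} (Q : probability (obs R d k) R).

(** Cubes with rational center and radius [1/(m+1)] that [A] almost surely avoids;
the complement of the support is their union.  They are indexed by [nat] through
[unpickle], for the countable union. *)
Definition null_cube (i : nat) : set (k.-tuple R) :=
  if unpickle i is Some (q, m) then
    let c := open_cube (fun j => ratr (tnth (q : k.-tuple rat) j)) m.+1%:R^-1 in
    if Q (obsA @^-1` c) == 0%E then c else set0
  else set0.

Let measurable_obsA_pre (S : set (k.-tuple R)) :
  measurable S -> measurable ((obsA : obs R d k -> _) @^-1` S).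
Proof. by move=> mS; rewrite -[_ @^-1` _]setTI; exact: measurable_obsA. Qed.

Let measurable_null_cube i : measurable (null_cube i).
Proof.
rewrite /null_cube; case: unpickle => [[q m]|]//; case: ifP => _ //.
exact: measurable_open_cube.
Qed.

Let null_cube0 i : Q (obsA @^-1` null_cube i) = 0%E.
Proof.
rewrite /null_cube; case: unpickle => [[q m]|]; last by rewrite preimage_set0 measure0.
by case: ifP => [/eqP//|_]; rewrite preimage_set0 measure0.
Qed.

(** A point outside the support has a null cube around it, which contains a
rational null cube around the point; conversely a null rational cube contains a
small cube around each of its points. *)
Lemma setC_suppA : ~` suppA Q = \bigcup_i null_cube i.
Proof.
apply/seteqP; split=> [a|a [i _]].
  move=> /existsNP[r /not_implyP[r0 /negP]].
  rewrite lt_neqAle measure_ge0 andbT negbK eq_sym => /eqP Q0.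
  pose m := Num.truncn (2 / r).
  have mr : m.+1%:R^-1 < r / 2.
    by rewrite invf_plt ?posrE ?divr_gt0// invf_div truncnS_gt.
  have /choice[q qP] : forall j : 'I_k, exists q : rat,
      `|tnth a j - ratr q| < m.+1%:R^-1.
    move=> j; have [|q] := @rat_in_itvoo R (tnth a j) (tnth a j + m.+1%:R^-1).
      by rewrite ltrDl invr_gt0.
    rewrite in_itv /= => /andP[h1 h2]; exists q.
    by rewrite distrC ger0_norm ?subr_ge0 ?ltW// ltrBlDl.
  exists (pickle ([tuple q j | j < k], m)) => //.
  rewrite /null_cube pickleK.
  set c := open_cube _ _.
  have ca : c a by move=> j; rewrite tnth_mktuple.
  suff -> : Q (obsA @^-1` c) = 0%E by rewrite eqxx.
  apply/eqP; rewrite eq_le measure_ge0 andbT -Q0 le_measure ?inE//.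
  - by apply: measurable_obsA_pre; exact: measurable_open_cube.
  - exact: (measurable_obsA_pre (measurable_open_cube (tnth a) r)).
  move=> z cz j; have := cz j; have := ca j.
  set x := tnth a j; set y := tnth (obsA z) j; set t := ratr _ => h1 h2.
  rewrite (_ : y - x = (y - t) - (x - t)); last by ring.
  rewrite (le_lt_trans (ler_normB _ _))//.
  by rewrite (lt_trans (ltrD h2 h1)) ?(lt_le_trans (ltrD mr mr))// -splitr.
rewrite /null_cube; case: unpickle => [[q m]|]//; case: ifP => [/eqP|]// Q0 ca.
set c := open_cube _ _ in Q0 ca.
(* The distance from [a] to the boundary of the rational cube. *)
pose r := \big[Order.min/1]_(j < k) (m.+1%:R^-1 - `|tnth a j - ratr (tnth q j)|).
have r0 : 0 < r.
  by rewrite lt_bigmin// => j _; rewrite subr_gt0; exact: ca.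
move=> /(_ r r0); rewrite lt_neqAle => /andP[/negP + _]; apply.
rewrite eq_sym eq_le measure_ge0 andbT -Q0 le_measure ?inE//.
- exact: (measurable_obsA_pre (measurable_open_cube (tnth a) r)).
- by apply: measurable_obsA_pre; exact: measurable_open_cube.
move=> z za j; have := za j.
have rj : r <= m.+1%:R^-1 - `|tnth a j - ratr (tnth q j)| by exact: bigmin_le.
set x := tnth a j in rj *; set y := tnth (obsA z) j; set t := ratr _ in rj *.
move=> /lt_le_trans /(_ rj) h.
rewrite (_ : y - t = (y - x) + (x - t)); last by ring.
by rewrite (le_lt_trans (ler_normD _ _))// -ltrBrDr.
Qed.

Lemma measurable_suppA : measurable (suppA Q).
Proof.
by rewrite -[suppA Q]setCK setC_suppA; apply: measurableC; exact: bigcupT_measurable.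
Qed.

Lemma ae_suppA : {ae Q, forall z, suppA Q (obsA z)}.
Proof.
have : Q.-negligible (\bigcup_i (obsA @^-1` null_cube i)).
  apply: negligible_bigcup => i; exists (obsA @^-1` null_cube i); split=> //.
    exact: measurable_obsA_pre.
  exact: null_cube0.
apply: negligibleS => z /= zA; rewrite -preimage_bigcup /= -setC_suppA; exact: zA.
Qed.

End support.

(** An almost sure bound on [A] holds at every point of the support: a point that
violates it is the center of a cube on which the bound fails. *)
Lemma suppA_bounded (R : realType) (d k : nat)
    (Q : probability (obs R d k) R) (B : R) :
  {ae Q, forall z, forall j : 'I_k, `|tnth (obsA z) j| <= B} ->
  forall a, suppA Q a -> forall j, `|tnth a j| <= B.
Proof.
move=> AB a Sa j; rewrite leNgt; apply/negP => Ba.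
have := Sa (`|tnth a j| - B); rewrite subr_gt0 => /(_ Ba).
set E := [set z | _]; suff : Q E = 0%E by move=> ->; rewrite ltxx.
have mE : measurable E.
  rewrite -[E]/(@obsA R d k @^-1` (open_cube (tnth a) (`|tnth a j| - B))).
  by rewrite -[_ @^-1` _]setTI; apply: measurable_obsA => //; exact: measurable_open_cube.
apply: measure_negligible => //.
apply: negligibleS AB => z Ez /= /(_ j); rewrite leNgt => /negP; apply.
have := Ez j; rewrite distrC => /(le_lt_trans (lerB_dist _ _)).
by rewrite ltrBlDr addrC -ltrBlDr opprB addrCA subrr addr0.
Qed.

(** * The regression function and the conditional density as integral identities *)

(** The residual has zero integral over the events defined by [(X, A)], so that its
positive and negative parts are weights with the same integral of every
nonnegative function of [(X, A)]; split [W] into its parts too. *)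
Lemma regression_orthogonal (R : realType) (d k : nat)
    (Q : probability (obs R d k) R) (mu W : d.-tuple R -> k.-tuple R -> R) :
  is_regression Q mu ->
  measurable_fun setT (fun u : d.-tuple R * k.-tuple R => W u.1 u.2) ->
  Q.-integrable setT (fun z =>
    ((obsY z - mu (obsX z) (obsA z)) * W (obsX z) (obsA z))%:E) ->
  (\int[Q]_z ((obsY z - mu (obsX z) (obsA z)) * W (obsX z) (obsA z))%:E = 0)%E.
Proof.
move=> [mmu iY imu HS] mW iW.
have mXA : measurable_fun setT (fun z : obs R d k => (obsX z, obsA z)).
  by apply: measurable_fun_pair; [exact: measurable_obsX|exact: measurable_obsA].
pose e z := obsY z - mu (obsX z) (obsA z).
have ie : Q.-integrable setT (EFin \o e).
  rewrite (_ : EFin \o e = fun z => ((obsY z)%:E - (mu (obsX z) (obsA z))%:E)%E)//.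
  exact: integrableB.
have me : measurable_fun setT e by apply/measurable_EFinP/measurable_int/ie.
pose ep z := Num.max (e z) 0.
pose en z := Num.max (- e z) 0.
have mep : measurable_fun setT ep by exact: measurable_maxr.
have men : measurable_fun setT en.
  by apply: measurable_maxr => //; exact: measurableT_comp.
have ep0 z : 0 <= ep z by rewrite le_max lexx orbT.
have en0 z : 0 <= en z by rewrite le_max lexx orbT.
have epnE z : e z = ep z - en z.
  rewrite /ep /en; have [h|h] := leP 0 (e z).
    by rewrite max_r ?oppr_le0// subr0.
  by rewrite max_l ?oppr_ge0 1?ltW// sub0r opprK.
have iep : Q.-integrable setT (EFin \o ep).
  apply: (le_integrable measurableT _ _ ie) => //; first exact/measurable_EFinP.
  move=> z _; rewrite /= lee_fin ger0_norm// /ep.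
  by rewrite ge_max ler_norm normr_ge0.
have ien : Q.-integrable setT (EFin \o en).
  apply: (le_integrable measurableT _ _ ie) => //; first exact/measurable_EFinP.
  move=> z _; rewrite /= lee_fin ger0_norm// /en.
  by rewrite -normrN ge_max ler_norm normr_ge0.
have mpre S : measurable S ->
    measurable ((fun z : obs R d k => (obsX z, obsA z)) @^-1` S).
  by move=> mS; rewrite -[_ @^-1` _]setTI; exact: mXA.
have sub (f : obs R d k -> \bar R) S : measurable S ->
    Q.-integrable setT f -> Q.-integrable ((fun z => (obsX z, obsA z)) @^-1` S) f.
  by move=> mS; apply: integrableS => //; exact: mpre.
have HE S : measurable S ->
    (\int[Q]_(z in (fun z => (obsX z, obsA z)) @^-1` S) (ep z)%:E =
     \int[Q]_(z in (fun z => (obsX z, obsA z)) @^-1` S) (en z)%:E)%E.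
  move=> mS.
  have fin f : Q.-integrable setT f ->
      (\int[Q]_(z in (fun z => (obsX z, obsA z)) @^-1` S) f z)%E \is a fin_num.
    by move=> fi; apply: integrable_fin_num; [exact: mpre|exact: sub].
  have sub0_eq (x y : \bar R) : x \is a fin_num -> y \is a fin_num ->
      (x - y = 0 -> x = y)%E.
    by case: x y => [x| |] [y| |]// _ _ [] /subr0_eq ->.
  apply: sub0_eq; [exact: (fin (EFin \o ep))|exact: (fin (EFin \o en))|].
  rewrite -integralB//; last 3 first.
  - exact: mpre.
  - exact: (sub (EFin \o ep)).
  - exact: (sub (EFin \o en)).
  under eq_integral do rewrite -EFinB -epnE EFinB.
  rewrite integralB; [|exact: mpre|exact: sub|exact: sub].
  by rewrite (HS S mS) subee//; exact: fin.
have tr (g : d.-tuple R * k.-tuple R -> R) : measurable_fun setT g ->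
    (forall u, 0 <= g u) ->
    (\int[Q]_z ((g (obsX z, obsA z))%:E * (ep z)%:E) =
     \int[Q]_z ((g (obsX z, obsA z))%:E * (en z)%:E))%E.
  move=> mg g0.
  have mgE : measurable_fun setT (EFin \o g) by exact/measurable_EFinP.
  have g0E u : (0 <= (EFin \o g) u)%E by rewrite lee_fin.
  exact: (eq_weighted_integral mXA mXA mep men ep0 en0 HE mgE g0E).
pose wp (u : d.-tuple R * k.-tuple R) := Num.max (W u.1 u.2) 0.
pose wn (u : d.-tuple R * k.-tuple R) := Num.max (- W u.1 u.2) 0.
have mwp : measurable_fun setT wp by exact: measurable_maxr.
have mwn : measurable_fun setT wn.
  by apply: measurable_maxr => //; exact: measurableT_comp.
have wp0 u : 0 <= wp u by rewrite le_max lexx orbT.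
have wn0 u : 0 <= wn u by rewrite le_max lexx orbT.
have wpnE u : W u.1 u.2 = wp u - wn u.
  rewrite /wp /wn; have [h|h] := leP 0 (W u.1 u.2).
    by rewrite max_r ?oppr_le0// subr0.
  by rewrite max_l ?oppr_ge0 1?ltW// sub0r opprK.
(* [a] and [b] are the positive and negative parts of the product. *)
pose a z := ep z * wp (obsX z, obsA z) + en z * wn (obsX z, obsA z).
pose b z := ep z * wn (obsX z, obsA z) + en z * wp (obsX z, obsA z).
have mwpz : measurable_fun setT (fun z : obs R d k => wp (obsX z, obsA z)).
  exact: (measurableT_comp mwp mXA).
have mwnz : measurable_fun setT (fun z : obs R d k => wn (obsX z, obsA z)).
  exact: (measurableT_comp mwn mXA).
have ma : measurable_fun setT a.
  by apply: measurable_funD; exact: measurable_funM.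
have mb : measurable_fun setT b.
  by apply: measurable_funD; exact: measurable_funM.
have a0 z : 0 <= a z by rewrite addr_ge0// mulr_ge0.
have b0 z : 0 <= b z by rewrite addr_ge0// mulr_ge0.
have abs_sum (x : R) : `|x| = Num.max x 0 + Num.max (- x) 0.
  have [h|h] := leP 0 x.
    by rewrite ger0_norm// max_r ?oppr_le0// addr0.
  by rewrite ltr0_norm// add0r max_l ?oppr_ge0 1?ltW.
have eW z : `|(obsY z - mu (obsX z) (obsA z)) * W (obsX z) (obsA z)| = a z + b z.
  rewrite normrM (abs_sum (obsY z - _)) (abs_sum (W _ _)).
  rewrite -/(e z) -/(ep z) -/(en z) -/(wp (obsX z, obsA z)) -/(wn (obsX z, obsA z)).
  by rewrite /a /b; ring.
have ia : Q.-integrable setT (EFin \o a).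
  apply: (le_integrable measurableT _ _ iW) => //; first exact/measurable_EFinP.
  by move=> z _; rewrite /= lee_fin eW ger0_norm// lerDl.
have ib : Q.-integrable setT (EFin \o b).
  apply: (le_integrable measurableT _ _ iW) => //; first exact/measurable_EFinP.
  by move=> z _; rewrite /= lee_fin eW ger0_norm// lerDr.
transitivity (\int[Q]_z ((a z)%:E - (b z)%:E))%E.
  apply: eq_integral => z _; rewrite -EFinB; congr EFin.
  rewrite -/(e z) epnE (wpnE (obsX z, obsA z)) /a /b; ring.
rewrite integralB//.
have -> : (\int[Q]_z (a z)%:E = \int[Q]_z (b z)%:E)%E.
  under eq_integral do rewrite EFinD.
  rewrite ge0_integralD//=; last 4 first.
  - by move=> z _; rewrite lee_fin mulr_ge0.
  - by apply/measurable_EFinP; exact: measurable_funM.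
  - by move=> z _; rewrite lee_fin mulr_ge0.
  - by apply/measurable_EFinP; exact: measurable_funM.
  under [in RHS]eq_integral do rewrite EFinD.
  rewrite ge0_integralD//=; last 4 first.
  - by move=> z _; rewrite lee_fin mulr_ge0.
  - by apply/measurable_EFinP; exact: measurable_funM.
  - by move=> z _; rewrite lee_fin mulr_ge0.
  - by apply/measurable_EFinP; exact: measurable_funM.
  rewrite addeC; congr (_ + _)%E.
  + under eq_integral do rewrite EFinM muleC.
    under [in RHS]eq_integral do rewrite EFinM muleC.
    by rewrite tr.
  + under eq_integral do rewrite EFinM muleC.
    under [in RHS]eq_integral do rewrite EFinM muleC.
    by rewrite tr.
by rewrite subee//; exact: integrable_fin_num.
Qed.

(** The law of [(X, A)] and the measure with density [pi_] agree on rectangles. *)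
Lemma cond_density_integral (R : realType) (d k : nat)
    (Q : probability (obs R d k) R) (pi_ : d.-tuple R -> k.-tuple R -> R)
    (g : d.-tuple R * k.-tuple R -> \bar R) :
  is_positive_cond_density Q pi_ ->
  measurable_fun setT g -> (forall u, 0 <= g u)%E ->
  (\int[Q]_z g (obsX z, obsA z) =
   \int[Q \x lebesgue_Rn k]_u
      (g (obsX u.1, u.2) * (pi_ (obsX u.1) u.2)%:E))%E.
Proof.
move=> [mpi pi0 piE _] mg g0.
have mX : measurable_fun setT (@obsX R d k).
  exact: (measurableT_comp measurable_fst measurable_fst).
have mA : measurable_fun setT (@obsA R d k).
  exact: (measurableT_comp measurable_snd measurable_fst).
have mXA : measurable_fun setT (fun z : obs R d k => (obsX z, obsA z)).
  exact: measurable_fun_pair.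
have mXa : measurable_fun setT
    (fun u : obs R d k * k.-tuple R => (obsX u.1, u.2)).
  by apply: measurable_fun_pair => //; exact: measurableT_comp.
have mw : measurable_fun setT
    (fun u : obs R d k * k.-tuple R => pi_ (obsX u.1) u.2).
  exact: (measurableT_comp mpi mXa).
under eq_integral do rewrite -[X in g X]/((fun z => (obsX z, obsA z)) _) -[g _]mule1.
apply: (@eq_weighted_integral _ _ _ _ _ _ _ Q _ _
  (fun u : obs R d k * k.-tuple R => (obsX u.1, u.2)) (cst 1)
  (fun u : obs R d k * k.-tuple R => pi_ (obsX u.1) u.2)) => //.
have [nu [nuE _]] := density_measure (Q \x lebesgue_Rn k)%E mw (fun=> pi0 _ _).
move=> S mS; rewrite -nuE; last by rewrite -[_ @^-1` _]setTI; exact: mXa.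
rewrite (integral_cst _ _ 1); last by rewrite -[_ @^-1` _]setTI; exact: mXA.
rewrite mul1e.
apply: (@measure_unique_prod _ _ _ _ _
   (@pushforward _ _ _ _ _ Q (fun z => (obsX z, obsA z)) : {measure set _ -> \bar R})
   (@pushforward _ _ _ _ _ nu
      (fun u : obs R d k * k.-tuple R => (obsX u.1, u.2)) :
      {measure set _ -> \bar R})) => //.
  by rewrite /= /pushforward preimage_setT probability_setT ltry.
move=> S1 S2 mS1 mS2; rewrite /= /pushforward nuE; last first.
  by rewrite -[_ @^-1` _]setTI; apply: mXa => //; exact: measurableX.
transitivity (Q [set z | S1 (obsX z) /\ S2 (obsA z)]); first by [].
rewrite piE// [LHS]integral_mkcond [RHS]integral_mkcond.
rewrite fubini_tonelli1//; last 2 first.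
- apply/(measurable_restrictT _ _).1.
    by rewrite -[_ @^-1` _]setTI; apply: mXa => //; exact: measurableX.
  by apply/measurable_funTS/measurable_EFinP.
- by move=> u; apply: erestrict_ge0 => ? _; rewrite lee_fin.
apply: eq_integral => z _; rewrite /fubini_F patchE.
have [zS|zS] := ifPn.
  rewrite [LHS]integral_mkcond; apply: eq_integral => a _.
  rewrite !patchE; move/set_mem : zS => zS.
  have [aS|aS] := ifPn; first by rewrite mem_set//; split=> //; exact: set_mem.
  by rewrite memNset// => -[_ /= aS']; move/negP: aS; apply; exact: mem_set.
rewrite [RHS]integral0_eq// => a _; rewrite patchE memNset// => -[/= zS' _].
by move/negP: zS; apply; exact: mem_set.
Qed.

Lemma cond_density_integrable (R : realType) (d k : nat)
    (Q : probability (obs R d k) R) (pi_ : d.-tuple R -> k.-tuple R -> R)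
    (g : d.-tuple R * k.-tuple R -> R) :
  is_positive_cond_density Q pi_ -> measurable_fun setT g ->
  Q.-integrable setT (fun z => (g (obsX z, obsA z))%:E) ->
  (Q \x lebesgue_Rn k)%E.-integrable setT
    (fun u => (g (obsX u.1, u.2) * pi_ (obsX u.1) u.2)%:E) /\
  (\int[Q]_z (g (obsX z, obsA z))%:E =
   \int[Q \x lebesgue_Rn k]_u (g (obsX u.1, u.2) * pi_ (obsX u.1) u.2)%:E)%E.
Proof.
move=> dens mg ig; have [mpi pi0 _ _] := dens.
have mgpi : measurable_fun setT
    (fun u : obs R d k * k.-tuple R => g (obsX u.1, u.2) * pi_ (obsX u.1) u.2).
  apply: measurable_funM; first exact: (measurableT_comp mg (@measurable_obsX_pair R d k)).
  exact: (measurableT_comp mpi (@measurable_obsX_pair R d k)).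
pose gp u := Num.max (g u) 0; pose gn u := Num.max (- g u) 0.
have mgp : measurable_fun setT gp by exact: measurable_maxr.
have mgn : measurable_fun setT gn.
  by apply: measurable_maxr => //; exact: measurableT_comp.
have gp0 u : 0 <= gp u by rewrite le_max lexx orbT.
have gn0 u : 0 <= gn u by rewrite le_max lexx orbT.
have gE u : g u = gp u - gn u.
  rewrite /gp /gn; have [h|h] := leP 0 (g u).
    by rewrite max_r ?oppr_le0// subr0.
  by rewrite max_l ?oppr_ge0 1?ltW// sub0r opprK.
have absE u : `|g u| = gp u + gn u.
  rewrite /gp /gn; have [h|h] := leP 0 (g u).
    by rewrite ger0_norm// max_r ?oppr_le0// addr0.
  by rewrite ltr0_norm// add0r max_l ?oppr_ge0 1?ltW.
have tr (h : d.-tuple R * k.-tuple R -> R) : measurable_fun setT h ->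
    (forall u, 0 <= h u) ->
    (\int[Q]_z (h (obsX z, obsA z))%:E = \int[Q \x lebesgue_Rn k]_u
      (h (obsX u.1, u.2) * pi_ (obsX u.1) u.2)%:E)%E.
  move=> mh h0; have mhE : measurable_fun setT (EFin \o h) by exact/measurable_EFinP.
  have h0E u : (0 <= (EFin \o h) u)%E by rewrite lee_fin.
  rewrite (cond_density_integral dens mhE h0E).
  by apply: eq_integral => u _; rewrite EFinM.
have ipos (h : d.-tuple R * k.-tuple R -> R) : measurable_fun setT h ->
    (forall u, 0 <= h u) -> (forall u, h u <= `|g u|) ->
    Q.-integrable setT (fun z => (h (obsX z, obsA z))%:E) /\
    (Q \x lebesgue_Rn k)%E.-integrable setT
      (fun u => (h (obsX u.1, u.2) * pi_ (obsX u.1) u.2)%:E).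
  move=> mh h0 hg.
  have mhz : measurable_fun setT (fun z : obs R d k => (h (obsX z, obsA z))%:E).
    by apply/measurable_EFinP; exact: (measurableT_comp mh (@measurable_obsXA R d k)).
  have ih : Q.-integrable setT (fun z => (h (obsX z, obsA z))%:E).
    apply: (le_integrable measurableT mhz _ ig) => z _.
    by rewrite /= lee_fin ger0_norm.
  split => //; apply/integrableP; split.
    apply/measurable_EFinP/measurable_funM.
      exact: (measurableT_comp mh (@measurable_obsX_pair R d k)).
    exact: (measurableT_comp mpi (@measurable_obsX_pair R d k)).
  under eq_integral do rewrite gee0_abs ?lee_fin ?mulr_ge0//.
  by rewrite -tr//; exact: integrable_lty.
have gpg u : gp u <= `|g u| by rewrite absE lerDl.
have gng u : gn u <= `|g u| by rewrite absE lerDr.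
have [igp igpp] := ipos _ mgp gp0 gpg.
have [ign ignp] := ipos _ mgn gn0 gng.
have gpiE (u : obs R d k * k.-tuple R) : ((g (obsX u.1, u.2) * pi_ (obsX u.1) u.2)%:E =
  (gp (obsX u.1, u.2) * pi_ (obsX u.1) u.2)%:E -
  (gn (obsX u.1, u.2) * pi_ (obsX u.1) u.2)%:E)%E.
  by rewrite -EFinB -mulrBl -gE.
split.
  have := integrableB measurableT igpp ignp.
  by apply: eq_integrable => // u _; rewrite gpiE.
under [RHS]eq_integral do rewrite gpiE.
rewrite integralB// -!tr//.
under eq_integral do rewrite gE EFinB.
by rewrite integralB.
Qed.

(** * The score and its bias *)

Section score.
Context {R : realType} {d k : nat}.

(** The inverse-probability-weighted residual; dividing by [p / f] gives [0] where
[f] vanishes. *)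
Definition ipw (m p : d.-tuple R -> k.-tuple R -> R) (f : k.-tuple R -> R)
    (z : obs R d k) (j : 'I_k) : R :=
  (obsY z - m (obsX z) (obsA z)) / (p (obsX z) (obsA z) / f (obsA z)) *
    tnth (obsA z) j.

Definition imputed (calA : set (k.-tuple R)) (psi0 : R)
    (m : d.-tuple R -> k.-tuple R -> R) (f : k.-tuple R -> R)
    (x : d.-tuple R) (j : 'I_k) : R :=
  \int[lebesgue_Rn k]_(a in calA) ((m x a - psi0) * tnth a j * f a).

(** Up to the factor [- 2], the linear part of the empirical risk is the average of
this vector over the second sample. *)
Definition score calA psi0 m p f (z : obs R d k) (j : 'I_k) : R :=
  ipw m p f z j + imputed calA psi0 m f (obsX z) j.

Lemma measurable_score d0 (T0 : measurableType d0) calA psi0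
    (m p : T0 -> d.-tuple R -> k.-tuple R -> R) (f : T0 -> k.-tuple R -> R) j :
  measurable calA ->
  measurable_fun setT (fun u : T0 * (d.-tuple R * k.-tuple R) =>
    m u.1 u.2.1 u.2.2) ->
  measurable_fun setT (fun u : T0 * (d.-tuple R * k.-tuple R) =>
    p u.1 u.2.1 u.2.2) ->
  measurable_fun setT (fun u : T0 * k.-tuple R => f u.1 u.2) ->
  measurable_fun setT (fun u : T0 * obs R d k =>
    score calA psi0 (m u.1) (p u.1) (f u.1) u.2 j).
Proof.
move=> mA mm mp mf.
have mtXA : measurable_fun setT (fun u : T0 * obs R d k =>
    (u.1, (obsX u.2, obsA u.2))).
  apply: measurable_fun_pair => //.
  exact: (measurableT_comp (@measurable_obsXA R d k)).
have mtA : measurable_fun setT (fun u : T0 * obs R d k => (u.1, obsA u.2)).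
  apply: measurable_fun_pair => //.
  exact: (measurableT_comp (@measurable_obsA R d k)).
have mj : measurable_fun setT (fun a : k.-tuple R => tnth a j).
  exact: measurable_tnth.
apply: measurable_funD.
  apply: measurable_funM; last first.
    exact: (measurableT_comp mj (measurableT_comp (@measurable_obsA R d k) measurable_snd)).
  apply: measurable_funM.
    apply: measurable_funB.
      exact: (measurableT_comp (@measurable_obsY R d k)).
    exact: (measurableT_comp mm mtXA).
  apply: (measurableT_comp (@measurable_inv R)).
  apply: measurable_funM; first exact: (measurableT_comp mp mtXA).
  by apply: (measurableT_comp (@measurable_inv R)); exact: (measurableT_comp mf mtA).
apply: (@measurable_Rintegral_param _ _ _ _ R (lebesgue_Rn k) calA
  (fun v : (T0 * obs R d k) * k.-tuple R =>
     (m v.1.1 (obsX v.1.2) v.2 - psi0) * tnth v.2 j * f v.1.1 v.2)) => //.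
have m1 : measurable_fun setT (fun v : (T0 * obs R d k) * k.-tuple R =>
    (v.1.1, (obsX v.1.2, v.2))).
  apply: measurable_fun_pair; first exact: measurableT_comp.
  apply: measurable_fun_pair => //.
  apply: (measurableT_comp (@measurable_obsX R d k)); exact: measurableT_comp.
have m2 : measurable_fun setT (fun v : (T0 * obs R d k) * k.-tuple R =>
    (v.1.1, v.2)).
  by apply: measurable_fun_pair => //; exact: measurableT_comp.
apply: measurable_funM; last exact: (measurableT_comp mf m2).
apply: measurable_funM; last exact: (measurableT_comp mj).
by apply: measurable_funB => //; exact: (measurableT_comp mm m1).
Qed.

Variable Q : probability (obs R d k) R.
Local Notation S := (suppA Q).
Local Notation L := (lebesgue_Rn k : {sigma_finite_measure set (k.-tuple R) -> \bar R}).

(** Collected for a fixed first sample, because they hold for almost every one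
only. *)
Record bounded_nuisance (B eps psi0 : R) (m p : d.-tuple R -> k.-tuple R -> R)
    (f : k.-tuple R -> R) : Prop := BoundedNuisance {
  nuisance_B_gt0 : 0 < B ;
  nuisance_eps_gt0 : 0 < eps ;
  measurable_muhat :
    measurable_fun setT (fun u : d.-tuple R * k.-tuple R => m u.1 u.2) ;
  measurable_pihat :
    measurable_fun setT (fun u : d.-tuple R * k.-tuple R => p u.1 u.2) ;
  measurable_phat : measurable_fun setT f ;
  phat_ge0 : forall a, 0 <= f a ;
  intercept_le : `|psi0| <= B ;
  pihat_ge : {ae Q, forall z, forall a, suppA Q a -> eps <= p (obsX z) a} ;
  obsY_le : {ae Q, forall z, `|obsY z| <= B} ;
  muhat_le : {ae Q, forall z, forall a, suppA Q a -> `|m (obsX z) a| <= B} ;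
  support_le : forall a, suppA Q a -> forall j, `|tnth a j| <= B ;
  phat_le : forall a, suppA Q a -> f a <= B ;
  phat_mass_le : (\int[lebesgue_Rn k]_(a in suppA Q) (f a)%:E <= B%:E)%E
}.

Section bounded_nuisance.
Variables (B eps psi0 : R) (m p : d.-tuple R -> k.-tuple R -> R)
  (f : k.-tuple R -> R).
Hypothesis nuis : bounded_nuisance B eps psi0 m p f.

Let B0 := nuisance_B_gt0 nuis.
Let eps0 := nuisance_eps_gt0 nuis.
Let mm := measurable_muhat nuis.
Let mp := measurable_pihat nuis.
Let mf := measurable_phat nuis.
Let f0 := phat_ge0 nuis.
Let psi0B := intercept_le nuis.
Let pe := pihat_ge nuis.
Let YB := obsY_le nuis.
Let mB := muhat_le nuis.
Let AB := support_le nuis.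
Let fB := phat_le nuis.
Let ifB := phat_mass_le nuis.

Let mS : measurable S := measurable_suppA Q.

Let mtnth (j : 'I_k) : measurable_fun setT (fun a : k.-tuple R => tnth a j).
Proof. exact: measurable_tnth. Qed.

Lemma imputed_integrable x (j : 'I_k) :
  (forall a, S a -> `|m x a| <= B) ->
  L.-integrable S (fun a => ((m x a - psi0) * tnth a j * f a)%:E) /\
  `|imputed S psi0 m f x j| <= 2 * B ^+ 3.
Proof.
move=> mxB.
have [|||i1 i2] := @weighted_Rintegral_bound _ _ _ L S f
  (fun a => (m x a - psi0) * tnth a j) B (2 * B * B) mS mf f0 ifB.
- apply: measurable_funM => //; apply: measurable_funB => //.
  exact: measurable_section1 mm.
- by rewrite !mulr_ge0// ltW.
- move=> a Sa; rewrite normrM ler_pM//; last exact: AB.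
  rewrite (le_trans (ler_normB _ _))// mulr2n mulrDl mul1r lerD//; exact: mxB.
split=> //; rewrite (_ : 2 * B ^+ 3 = 2 * B * B * B); last by ring.
exact: Rintegral_norm_le.
Qed.

Let good z := [/\ S (obsA z), `|obsY z| <= B,
  forall a, S a -> `|m (obsX z) a| <= B & forall a, S a -> eps <= p (obsX z) a].

Lemma ae_good : {ae Q, forall z, good z}.
Proof.
have h1 : {ae Q, forall z, S (obsA z) /\ `|obsY z| <= B}.
  by move: (ae_suppA Q) YB; apply: filterS2 => z.
have h2 : {ae Q, forall z, (forall a, S a -> `|m (obsX z) a| <= B) /\
    (forall a, S a -> eps <= p (obsX z) a)}.
  by move: mB pe; apply: filterS2 => z.
by move: h1 h2; apply: filterS2 => z [? ?] [? ?].
Qed.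

Let K := B / eps * B.

Let K0 : 0 <= K.
Proof. by rewrite mulr_ge0 ?divr_ge0// ltW. Qed.

Lemma weight_le x a j : S a -> (forall a, S a -> eps <= p x a) ->
  `|f a / p x a * tnth a j| <= K.
Proof.
move=> Sa px; rewrite normrM ler_pM//; last exact: AB.
have p0 : 0 < p x a by rewrite (lt_le_trans eps0)// px.
rewrite normrM normfV !ger0_norm ?(ltW p0)//.
rewrite ler_pM ?invr_ge0 ?(ltW p0)//; first exact: fB.
by rewrite lef_pV2 ?posrE// px.
Qed.

Lemma ipwE z j : ipw m p f z j =
  (obsY z - m (obsX z) (obsA z)) * (f (obsA z) / p (obsX z) (obsA z) * tnth (obsA z) j).
Proof. by rewrite /ipw invf_div mulrA. Qed.

(** Both terms are bounded on the event where [A] lies in its support and the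
pointwise bounds hold on the whole support. *)
Lemma score_bounded : {ae Q, forall z, forall j,
  `|score S psi0 m p f z j| <= 2 * B * K + 2 * B ^+ 3}.
Proof.
apply: filterS ae_good => z [zS Yz mz pz] j.
rewrite (le_trans (ler_normD _ _))// lerD//; last by have [] := imputed_integrable j mz.
rewrite ipwE normrM ler_pM//; last exact: weight_le.
by rewrite (le_trans (ler_normB _ _))// mulr2n mulrDl mul1r lerD// mz.
Qed.

Lemma measurable_score1 j : measurable_fun setT (fun z => score S psi0 m p f z j).
Proof.
have ms := @measurable_score _ unit S psi0 (fun=> m) (fun=> p) (fun=> f) j mS.
have m2 : measurable_fun setT
    (fun u : unit * (d.-tuple R * k.-tuple R) => u.2) by exact: measurable_snd.
have m3 : measurable_fun setT (fun u : unit * k.-tuple R => u.2) by exact: measurable_snd.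
(* Estimators that do not depend on a parameter are a family over [unit]. *)
have {}ms := ms (measurableT_comp mm m2) (measurableT_comp mp m2)
  (measurableT_comp mf m3).
exact: (measurableT_comp ms (measurable_pair1 tt)).
Qed.

Lemma moment_integrable i j :
  L.-integrable S (fun a => (tnth a i * tnth a j * f a)%:E).
Proof.
have [|||//] := @weighted_Rintegral_bound _ _ _ L S f
  (fun a => tnth a i * tnth a j) B (B * B) mS mf f0 ifB.
- exact: measurable_funM.
- by rewrite mulr_ge0// ltW.
- by move=> a Sa; rewrite normrM ler_pM// AB.
Qed.

Lemma Rintegral_dot_coord (v : k.-tuple R) j :
  L.-integrable S (fun a => (tnth a j * dotRn a v * f a)%:E) /\
  \int[L]_(a in S) (tnth a j * dotRn a v * f a) =
    \sum_l tnth v l * second_moment S f j l.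
Proof.
have E a : tnth a j * dotRn a v * f a =
    \sum_l tnth v l * (tnth a j * tnth a l * f a).
  rewrite /dotRn mulr_sumr mulr_suml; apply: eq_bigr => l _; ring.
have [h1 h2] := @Rintegral_lin _ _ _ L S _
  (fun l a => tnth a j * tnth a l * f a) (tnth v) mS (moment_integrable j).
split; first by under eq_fun do rewrite E.
under eq_Rintegral do rewrite E.
by rewrite h2; apply: eq_bigr => l _; rewrite mxE.
Qed.

Lemma Rintegral_dot_dot (v : k.-tuple R) :
  L.-integrable S (fun a => (dotRn a v ^+ 2 * f a)%:E) /\
  \int[L]_(a in S) (dotRn a v ^+ 2 * f a) =
    \sum_j \sum_l tnth v j * tnth v l * second_moment S f j l.
Proof.
have E a : dotRn a v ^+ 2 * f a = \sum_j tnth v j * (tnth a j * dotRn a v * f a).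
  rewrite expr2 {1}/dotRn !mulr_suml; apply: eq_bigr => l _; ring.
have [h1 h2] := @Rintegral_lin _ _ _ L S _
  (fun l a => tnth a l * dotRn a v * f a) (tnth v) mS
  (fun j => (Rintegral_dot_coord v j).1).
split; first by under eq_fun do rewrite E.
under eq_Rintegral do rewrite E.
rewrite h2; apply: eq_bigr => j _; rewrite (Rintegral_dot_coord v j).2 mulr_sumr.
by apply: eq_bigr => l _; rewrite mulrA.
Qed.

(** Only integrability is assumed of [m], because that is a measurable condition on
the two samples, unlike a bound at every point of the support. *)
Lemma imputed_dot x (b : k.-tuple R) :
  L.-integrable S (fun a => ((m x a - psi0) * f a)%:E) ->
  \int[L]_(a in S) ((m x a - psi0) * dotRn a b * f a) =
  \sum_j tnth b j * imputed S psi0 m f x j.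
Proof.
move=> iS.
have ij j : L.-integrable S (fun a => ((m x a - psi0) * tnth a j * f a)%:E).
  have iBS := integrableZl mS B iS.
  apply: (le_integrable mS _ _ iBS).
    apply/measurable_funTS/measurable_EFinP.
    apply: measurable_funM => //; apply: measurable_funM => //.
    by apply: measurable_funB => //; exact: measurable_section1 mm.
  move=> a Sa; rewrite lee_fin mulrAC normrM mulrC normrM ler_wpM2r//.
  by rewrite (le_trans (AB Sa j))// ler_norm.
have [_ <-] := @Rintegral_lin _ _ _ L S _
  (fun j a => (m x a - psi0) * tnth a j * f a) (tnth b) mS ij.
apply: eq_Rintegral => a _; rewrite /dotRn mulr_sumr mulr_suml.
by apply: eq_bigr => j _; ring.
Qed.

Section bias.
Variables (mu pi_ : d.-tuple R -> k.-tuple R -> R) (psi : k.-tuple R)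
  (delta epsn : R).
Hypothesis reg : is_regression Q mu.
Hypothesis dens : is_positive_cond_density Q pi_.
Hypothesis msm : forall a, S a ->
  (\int[Q]_z (mu (obsX z) a)%:E)%E = (psi0 + dotRn psi a)%:E.
Hypothesis pi_err : forall a, S a ->
  (normX Q (fun x => (pi_ x a / p x a - 1)%R) <= delta%:E)%E.
Hypothesis mu_err : forall a, S a ->
  (normX Q (fun x => (mu x a - m x a)%R) <= epsn%:E)%E.

Let mmu : measurable_fun setT (fun u : d.-tuple R * k.-tuple R => mu u.1 u.2).
Proof. by case: reg. Qed.

Let mpi : measurable_fun setT (fun u : d.-tuple R * k.-tuple R => pi_ u.1 u.2).
Proof. by case: dens. Qed.

Let m1S : measurable_fun setT (\1_S : k.-tuple R -> R).
Proof. exact: measurable_indic. Qed.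

Let W j (x : d.-tuple R) a := \1_S a * (f a / p x a * tnth a j).

Let mW j : measurable_fun setT (fun u : d.-tuple R * k.-tuple R => W j u.1 u.2).
Proof.
apply: measurable_funM.
  exact: (measurableT_comp m1S measurable_snd).
apply: measurable_funM; last exact: (measurableT_comp (mtnth j)).
apply: measurable_funM; first exact: (measurableT_comp mf measurable_snd).
exact: (measurableT_comp (@measurable_inv R) mp).
Qed.

Let W_le j : {ae Q, forall z, `|W j (obsX z) (obsA z)| <= K}.
Proof.
apply: filterS ae_good => z [zS _ _ pz].
by rewrite /W indicE mem_set// mul1r weight_le.
Qed.

Let residual_integral j :
  Q.-integrable setT (fun z =>
    ((obsY z - mu (obsX z) (obsA z)) * W j (obsX z) (obsA z))%:E) /\
  (\int[Q]_z ((obsY z - mu (obsX z) (obsA z)) * W j (obsX z) (obsA z))%:E = 0)%E.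
Proof.
have [_ iY imu _] := reg.
have i1 : Q.-integrable setT (fun z =>
    ((obsY z - mu (obsX z) (obsA z)) * W j (obsX z) (obsA z))%:E).
  apply: (@integrableM_ae_bounded _ _ _ Q (fun z => obsY z - mu (obsX z) (obsA z))
    (fun z => W j (obsX z) (obsA z)) K).
  - exact: (integrableB measurableT iY imu).
  - exact: (measurableT_comp (mW j) (@measurable_obsXA R d k)).
  - exact: W_le.
by split=> //; exact: (regression_orthogonal reg (mW j)).
Qed.

(* [G] times the density and [H] are the two functions of the observation and of
   [a] whose integrals add up to the bias. *)
Let G j (u : d.-tuple R * k.-tuple R) := (mu u.1 u.2 - m u.1 u.2) * W j u.1 u.2.

Let mG j : measurable_fun setT (G j).
Proof. by apply: measurable_funM => //; exact: measurable_funB. Qed.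

Let iG j : Q.-integrable setT (fun z => (G j (obsX z, obsA z))%:E).
Proof.
have [_ iY imu _] := reg.
have mWz : measurable_fun setT (fun z : obs R d k => W j (obsX z) (obsA z)).
  exact: (measurableT_comp (mW j) (@measurable_obsXA R d k)).
have i1 : Q.-integrable setT (EFin \o
    (fun z => mu (obsX z) (obsA z) * W j (obsX z) (obsA z))).
  by apply: (@integrableM_ae_bounded _ _ _ Q (fun z => mu (obsX z) (obsA z)) _ K).
have i2 : Q.-integrable setT (EFin \o
    (fun z => m (obsX z) (obsA z) * W j (obsX z) (obsA z))).
  apply: (@integrable_ae_bounded _ _ _ Q _ (B * K)).
    by apply: measurable_funM => //; exact: (measurableT_comp mm (@measurable_obsXA R d k)).
  move: ae_good (W_le j); apply: filterS2 => z [zS _ mz _] Wz.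
  by rewrite normrM ler_pM// mz.
have := integrableB measurableT i1 i2.
by apply: eq_integrable => // z _; rewrite /= -EFinB /G mulrBl.
Qed.

Let H j (u : obs R d k * k.-tuple R) := \1_S u.2 *
  ((m (obsX u.1) u.2 - (psi0 + dotRn psi u.2)) * tnth u.2 j * f u.2).

Let mH j : measurable_fun setT (H j).
Proof.
apply: measurable_funM; first exact: (measurableT_comp m1S measurable_snd).
apply: measurable_funM; last exact: (measurableT_comp mf).
apply: measurable_funM; last exact: (measurableT_comp (mtnth j)).
apply: measurable_funB; first exact: (measurableT_comp mm (@measurable_obsX_pair R d k)).
apply: measurable_funD => //.
have := @measurable_dotRn R k psi; under eq_fun do rewrite dotRnC.
by move=> h; exact: (measurableT_comp h).
Qed.

Let slice_bound (z : obs R d k) j : (forall a, S a -> `|m (obsX z) a| <= B) ->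
  (\int[L]_a `|(H j (z, a))%:E| <=
    ((2 * B + \sum_l B * `|tnth psi l|) * B * B)%:E)%E.
Proof.
move=> mz.
have -> : (fun a => `|(H j (z, a))%:E|%E) = (fun a =>
  `|((m (obsX z) a - (psi0 + dotRn psi a)) * tnth a j * f a)%:E|%E) \_ S.
  apply/funext => a; rewrite /H patchE indicE /=.
  by case: ifPn => aS; rewrite ?mul1r// mul0r normr0.
rewrite -integral_mkcond.
have dpsi a : S a -> `|dotRn psi a| <= \sum_l B * `|tnth psi l|.
  move=> Sa; rewrite (le_trans (ler_norm_sum _ _ _))// ler_sum// => l _.
  by rewrite normrM mulrC ler_wpM2r// AB.
have c0 : 0 <= \sum_l B * `|tnth psi l|.
  by rewrite sumr_ge0// => l _; rewrite mulr_ge0// ltW.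
have [|||_ //] := @weighted_Rintegral_bound _ _ _ L S f
  (fun a => (m (obsX z) a - (psi0 + dotRn psi a)) * tnth a j) B
  ((2 * B + \sum_l B * `|tnth psi l|) * B) mS mf f0 ifB.
- apply: measurable_funM => //; apply: measurable_funB.
    exact: measurable_section1 mm.
  apply: measurable_funD => //.
  by have := @measurable_dotRn R k psi; under eq_fun do rewrite dotRnC.
- by rewrite mulr_ge0 ?addr_ge0 ?mulr_ge0// ltW.
- move=> a Sa; rewrite normrM ler_pM//; last exact: AB.
  rewrite opprD addrA (le_trans (ler_normB _ _))// lerD//; last exact: dpsi.
  rewrite (le_trans (ler_normB _ _))// mulr2n mulrDl mul1r lerD//; exact: mz.
Qed.

Let iH j : (Q \x L)%E.-integrable setT (EFin \o H j).
Proof.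
have mHE : measurable_fun setT (EFin \o H j) by exact/measurable_EFinP.
apply/integrable12ltyP => //.
pose c := (2 * B + \sum_l B * `|tnth psi l|) * B * B.
apply: (@le_lt_trans _ _ (\int[Q]_z c%:E)%E); last first.
  by rewrite integral_cst_probability ltry.
have c0 : 0 <= c.
  rewrite !mulr_ge0 ?addr_ge0 ?mulr_ge0// ?(ltW B0)//.
  by rewrite sumr_ge0// => l _; rewrite mulr_ge0// ltW.
apply: ae_ge0_le_integral => //.
- by move=> z _; apply: integral_ge0.
- have mabs : measurable_fun setT (abse \o (EFin \o H j)) by exact: measurableT_comp.
  exact: (measurable_fun_fubini_tonelli_F (m2 := L) _ mabs (fun=> abse_ge0 _)).
- by move: ae_good; apply: filterS => z [_ _ mz _] _; exact: slice_bound.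
Qed.

Let integral_slice j (z : obs R d k) : (forall a, S a -> `|m (obsX z) a| <= B) ->
  (\int[L]_a (H j (z, a))%:E =
   (imputed S psi0 m f (obsX z) j -
    \sum_l tnth psi l * second_moment S f j l)%:E)%E.
Proof.
move=> mz.
have [i1 _] := imputed_integrable j mz.
have [i2 e2] := Rintegral_dot_coord psi j.
rewrite -e2 /imputed -RintegralB//.
have i12 := integrableB mS i1 i2.
rewrite /Rintegral fineK; last first.
  apply: integrable_fin_num => //.
rewrite [RHS]integral_mkcond; apply: eq_integral => a _.
rewrite patchE /H indicE /=; case: ifPn => aS; last by rewrite mul0r.
by rewrite mul1r (dotRnC psi); congr EFin; ring.
Qed.

Let inner_bound j a : S a ->
  (`|\int[Q]_z (G j (obsX z, a) * pi_ (obsX z) a + H j (z, a))%:E| <=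
    (B * (epsn * delta))%:E * (f a)%:E)%E.
Proof.
move=> Sa.
pose u (z : obs R d k) := mu (obsX z) a - m (obsX z) a.
pose v (z : obs R d k) := pi_ (obsX z) a / p (obsX z) a - 1.
have mmua := @measurable_section2 R d k mu a mmu.
have mma := @measurable_section2 R d k m a mm.
have mu_ : measurable_fun setT u by exact: measurable_funB.
have mv : measurable_fun setT v.
  apply: measurable_funB => //; apply: measurable_funM.
    exact: measurable_section2 mpi.
  by apply: (measurableT_comp (@measurable_inv R)); exact: measurable_section2 mp.
have [iuv uvle] := L2_integral_mul mu_ mv (mu_err Sa) (pi_err Sa).
have imua : Q.-integrable setT (fun z => (mu (obsX z) a)%:E).
  apply: fin_num_integrable; first exact/measurable_EFinP.
  by rewrite msm.
pose c := psi0 + dotRn psi a.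
have imc : Q.-integrable setT (fun z => ((mu (obsX z) a)%:E - c%:E)%E).
  by apply: integrableB => //; exact: finite_measure_integrable_cst.
have -> : (\int[Q]_z (G j (obsX z, a) * pi_ (obsX z) a + H j (z, a))%:E =
    (tnth a j * f a)%:E * \int[Q]_z (u z * v z)%:E)%E.
  rewrite -[RHS]adde0 -[X in (_ = _ + X)%E](mule0 (tnth a j * f a)%:E).
  have -> : (0 = \int[Q]_z ((mu (obsX z) a)%:E - c%:E))%E.
    rewrite integralB//; last exact: finite_measure_integrable_cst.
    by rewrite integral_cst_probability msm// subee.
  rewrite -muleDr//; last first.
    by rewrite fin_num_adde_defr//; exact: integrable_fin_num.
  rewrite -integralD// -integralZl//; last exact: integrableD.
  apply: eq_integral => z _; rewrite -EFinB -EFinD -EFinM; congr EFin.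
  by rewrite /G /H /W /u /v /c indicE mem_set//=; ring.
rewrite abseM -EFinM; apply: (@le_trans _ _ ((B * f a)%:E * (epsn * delta)%:E)%E).
  apply: lee_pmul => //.
  by rewrite lee_fin normrM (ger0_norm (f0 a)) ler_wpM2r// AB.
by rewrite -EFinM lee_fin; lra.
Qed.

(** The doubly robust identity: the bias is the integral over [a] in the support of
[a_j f(a) E[(mu_a - m_a)(pi_a / p_a - 1)]].  It is reached by splitting the
weighted residual into a part orthogonal to functions of [(X, A)] and a part that
is integrated against the conditional density. *)
Lemma score_bias j :
  `|\int[Q]_z score S psi0 m p f z j - \sum_l tnth psi l * second_moment S f j l|
  <= B ^+ 2 * (epsn * delta).
Proof.
set c := \sum_l _.
have isc : Q.-integrable setT (EFin \o (fun z => score S psi0 m p f z j)).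
  apply: (@integrable_ae_bounded _ _ _ Q _ (2 * B * K + 2 * B ^+ 3)).
    exact: measurable_score1.
  by apply: filterS score_bounded => z; apply.
have ic : Q.-integrable setT (EFin \o (fun _ : obs R d k => c)).
  exact: finite_measure_integrable_cst.
have -> : \int[Q]_z score S psi0 m p f z j - c =
    \int[Q]_z (score S psi0 m p f z j - c).
  rewrite RintegralB//; congr (_ - _).
  by rewrite /Rintegral integral_cst_probability.
have [iR eR] := residual_integral j.
have [iGp eG] := cond_density_integrable dens (mG j) (iG j).
have eH := integral12_prod_meas1 (iH j).
have iF := integrable_fubini_F (iH j).
pose Phi u := G j (obsX u.1, u.2) * pi_ (obsX u.1) u.2 + H j u.
have iPhi : (Q \x L)%E.-integrable setT (EFin \o Phi).
  have := integrableD measurableT iGp (iH j).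
  by apply: eq_integrable => // u _; rewrite /= -EFinD.
have iRG := integrableD measurableT iR (iG j).
have eE : (\int[Q]_z (score S psi0 m p f z j - c)%:E =
    \int[Q \x L]_u (Phi u)%:E)%E.
  transitivity (\int[Q]_z (
     (((obsY z - mu (obsX z) (obsA z)) * W j (obsX z) (obsA z))%:E +
     (G j (obsX z, obsA z))%:E) + fubini_F L (EFin \o H j) z))%E.
    apply: ae_eq_integral => //.
    - apply/measurable_EFinP; apply: measurable_funB => //.
      exact: measurable_score1.
    - exact: (measurable_int Q (integrableD measurableT iRG iF)).
    - move: ae_good; apply: filterS => z [zS _ mz _] _.
      rewrite /fubini_F /= (integral_slice _ mz) -!EFinD; congr EFin.
      by rewrite /score ipwE /G /W indicE mem_set//= -/c; ring.
  rewrite (integralD measurableT iRG iF) (integralD measurableT iR (iG j)).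
  rewrite eR add0e eG eH.
  by rewrite -integralD.
rewrite -lee_fin /Rintegral -abse_EFin fineK; last first.
  rewrite eE; exact: integrable_fin_num.
rewrite eE -(integral21_prod_meas1 iPhi).
have mG2 := measurable_fubini_G iPhi.
apply: (le_trans (le_abse_integral _ _ mG2)) => //.
apply: (@le_trans _ _ (\int[L]_(a in S) ((B * (epsn * delta))%:E * (f a)%:E))%E).
  rewrite [leRHS]integral_mkcond; apply: ge0_le_integral => //.
  - exact: measurableT_comp.
  - apply/(measurable_restrictT _ _).1 => //.
    apply: emeasurable_funM => //.
    by apply/measurable_funTS/measurable_EFinP.
  - move=> a _; rewrite patchE; case: ifPn => [/set_mem aS|aS].
      by rewrite /fubini_G; exact: inner_bound.
    rewrite /fubini_G integral0_eq ?abse0// => z _.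
    by rewrite /= /Phi /G /H /W /= indicE (negbTE aS) /=; congr EFin; ring.
(* The bounds on the errors are nonnegative because the support is nonempty. *)
have [a Sa] : exists a, S a.
  have /negligibleS : Q.-negligible (~` [set z | S (obsA z)]) by exact: ae_suppA.
  move=> neg; apply: contrapT => /forallNP nS.
  have : Q setT = 0%E.
    by apply: measure_negligible => //; apply: neg => z _ /=; exact: nS.
  by rewrite probability_setT => /eqP; rewrite eqe oner_eq0.
have e0 : 0 <= epsn.
  by rewrite -lee_fin (le_trans _ (mu_err Sa))// Lnorm_ge0.
have d0 : 0 <= delta.
  by rewrite -lee_fin (le_trans _ (pi_err Sa))// Lnorm_ge0.
rewrite ge0_integralZl//; last 3 first.
- by apply/measurable_funTS/measurable_EFinP.
- by move=> b _; rewrite lee_fin.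
- by rewrite lee_fin !mulr_ge0// ltW.
rewrite (_ : B ^+ 2 * (epsn * delta) = B * (epsn * delta) * B); last by ring.
by rewrite [leRHS]EFinM lee_wpmul2l// lee_fin !mulr_ge0// ltW.
Qed.

End bias.

End bounded_nuisance.
End score.

(** * The empirical risk and the deviations of the second sample *)

Lemma second_moment_sym (R : realType) (k : nat) (calA : set (k.-tuple R)) f :
  (second_moment calA f)^T = second_moment calA f.
Proof.
apply/matrixP => i j; rewrite !mxE; apply: eq_Rintegral => a _.
by rewrite (mulrC (tnth a j)).
Qed.

Lemma emp_risk_quadratic (R : realType) (d k n : nat)
    (Q : probability (obs R d k) R) (B eps psi0 : R)
    (m p : d.-tuple R -> k.-tuple R -> R) (f : k.-tuple R -> R)
    (t : n.-tuple (obs R d k)) (b : k.-tuple R) :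
  bounded_nuisance Q B eps psi0 m p f ->
  (forall i, (lebesgue_Rn k).-integrable (suppA Q)
     (fun a => ((m (obsX (tnth t i)) a - psi0) * f a)%:E)) ->
  emp_risk (suppA Q) psi0 m p f t b =
  - 2 * (\sum_j tnth b j *
          (n%:R^-1 * \sum_(i < n) score (suppA Q) psi0 m p f (tnth t i) j)) +
  bilin (second_moment (suppA Q) f) (rowRn b) (rowRn b).
Proof.
move=> nuis it; rewrite /emp_risk; congr (_ * _ + _); last first.
  rewrite (Rintegral_dot_dot nuis b).2 bilin_rowRn.
  by apply: eq_bigr => i _; apply: eq_bigr => j _; ring.
have -> : \sum_j tnth b j * (n%:R^-1 *
      \sum_(i < n) score (suppA Q) psi0 m p f (tnth t i) j) =
    n%:R^-1 * \sum_(i < n) \sum_j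
      tnth b j * score (suppA Q) psi0 m p f (tnth t i) j.
  rewrite exchange_big /= mulr_sumr; apply: eq_bigr => j _.
  by rewrite mulrCA mulr_sumr.
congr (_ * _); apply: eq_bigr => i _ /=.
rewrite (imputed_dot nuis b (it i)) {1}/dotRn mulr_sumr -big_split /=.
by apply: eq_bigr => j _; rewrite /score /ipw; ring.
Qed.

Section two_samples.
Context {R : realType} {d k n : nat} (Q : probability (obs R d k) R)
  {dO : measure_display} {T : measurableType dO} (P : probability T R)
  (D1 D2 : {RV P >-> n.-tuple (obs R d k)}) (B eps psi0 : R)
  (muhat pihat : n.-tuple (obs R d k) -> d.-tuple R -> k.-tuple R -> R)
  (phat : n.-tuple (obs R d k) -> k.-tuple R -> R).
Hypotheses (iid2 : iid_sample D2 Q) (D12 : indep_rv D1 D2).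
Hypothesis mmuhat :
  measurable_fun setT (fun u : n.-tuple (obs R d k) * (d.-tuple R * k.-tuple R)
    => muhat u.1 u.2.1 u.2.2).
Hypothesis mpihat :
  measurable_fun setT (fun u : n.-tuple (obs R d k) * (d.-tuple R * k.-tuple R)
    => pihat u.1 u.2.1 u.2.2).
Hypothesis mphat : measurable_fun setT
  (fun u : n.-tuple (obs R d k) * k.-tuple R => phat u.1 u.2).
Hypothesis nuis : {ae P, forall w,
  bounded_nuisance Q B eps psi0 (muhat (D1 w)) (pihat (D1 w)) (phat (D1 w))}.

Local Notation S := (suppA Q).
Local Notation L := (lebesgue_Rn k).
Local Notation sample := (n.-tuple (obs R d k)).

Let mS : measurable S := measurable_suppA Q.

Let imputed_abs (u : sample * obs R d k) : \bar R :=
  (\int[L]_(a in S) `|((muhat u.1 (obsX u.2) a - psi0) * phat u.1 a)%:E|)%E.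

Let measurable_imputed_abs : measurable_fun setT imputed_abs.
Proof.
pose g (v : (sample * obs R d k) * k.-tuple R) : \bar R :=
  (`|((muhat v.1.1 (obsX v.1.2) v.2 - psi0) * phat v.1.1 v.2)%:E| *
   (\1_S v.2)%:E)%E.
have m1 : measurable_fun setT (fun v : (sample * obs R d k) * k.-tuple R =>
    (v.1.1, (obsX v.1.2, v.2))).
  apply: measurable_fun_pair; first exact: measurableT_comp.
  apply: measurable_fun_pair => //.
  apply: (measurableT_comp (@measurable_obsX R d k)); exact: measurableT_comp.
have m2 : measurable_fun setT (fun v : (sample * obs R d k) * k.-tuple R =>
    (v.1.1, v.2)).
  by apply: measurable_fun_pair => //; exact: measurableT_comp.
have mg : measurable_fun setT g.
  apply: emeasurable_funM.
    apply: measurableT_comp => //; apply/measurable_EFinP.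
    apply: measurable_funM; last exact: (measurableT_comp mphat m2).
    by apply: measurable_funB => //; exact: (measurableT_comp mmuhat m1).
  apply/measurable_EFinP.
  have m1S : measurable_fun setT (\1_S : k.-tuple R -> R) by exact: measurable_indic.
  exact: (measurableT_comp m1S measurable_snd).
have g0 v : (0 <= g v)%E by rewrite mule_ge0// lee_fin.
have := measurable_fun_fubini_tonelli_F (m2 := L) g mg g0.
rewrite (_ : fubini_F _ _ = imputed_abs)//.
apply/funext => u; rewrite /fubini_F /imputed_abs [RHS]integral_mkcond.
by apply: eq_integral => a _; rewrite epatch_indic.
Qed.

(** Finiteness of the integral of the absolute value is a measurable condition on
the pair of samples, and independence transfers it from a fixed first sample to
the second one. *)
Lemma ae_imputed_integrable : {ae P, forall w, forall i,
  L.-integrable S (fun a =>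
    ((muhat (D1 w) (obsX (tnth (D2 w) i)) a - psi0) * phat (D1 w) a)%:E)}.
Proof.
have mint (u : sample * obs R d k) : measurable_fun S
    (fun a => ((muhat u.1 (obsX u.2) a - psi0) * phat u.1 a)%:E).
  apply/measurable_funTS/measurable_EFinP; apply: measurable_funM.
    apply: measurable_funB => //.
    have := measurableT_comp mmuhat (measurable_pair1 u.1).
    by move=> h; exact: (measurableT_comp h (measurable_pair1 (obsX u.2))).
  exact: (measurableT_comp mphat (measurable_pair1 u.1)).
suff H i : {ae P, forall w, imputed_abs (D1 w, tnth (D2 w) i) != +oo%E}.
  have : {ae P, forall w, forall i, imputed_abs (D1 w, tnth (D2 w) i) != +oo%E}.
    exact: filter_forall.
  apply: filterS => w wi i; apply/integrableP; split.
    exact: (mint (D1 w, tnth (D2 w) i)).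
  by rewrite ltey; exact: wi.
have mt : measurable_fun setT (fun u : sample * sample => (u.1, tnth u.2 i)).
  apply: measurable_fun_pair => //.
  exact: (measurableT_comp (measurable_tnth i)).
pose N := [set u : sample * sample | imputed_abs (u.1, tnth u.2 i) = +oo%E].
have mN : measurable N.
  have := measurableT_comp measurable_imputed_abs mt.
  by move=> /(_ measurableT [set +oo%E] (emeasurable_set1 _)); rewrite setTI.
have : {ae P, forall w, ~ N (D1 w, D2 w)}; last first.
  by apply: filterS => w /eqP.
apply: (indep_ae D12 mN); apply: filterS nuis => w nw.
pose Nz := [set z | imputed_abs (D1 w, z) = +oo%E].
have mNz : measurable Nz.
  have := measurableT_comp measurable_imputed_abs (measurable_pair1 (D1 w)).
  by move=> /(_ measurableT [set +oo%E] (emeasurable_set1 _)); rewrite setTI.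
rewrite [LHS](iid2.1 i Nz mNz); apply: measure_negligible => //.
apply: negligibleS (muhat_le nw) => z Nzz /= mz.
have [||| _] := @weighted_Rintegral_bound _ _ _ L S (phat (D1 w))
  (fun a => muhat (D1 w) (obsX z) a - psi0) B (2 * B) mS (measurable_phat nw)
  (phat_ge0 nw) (phat_mass_le nw).
- apply: measurable_funB => //.
  exact: (measurable_section1 _ (measurable_muhat nw)).
- by rewrite mulr_ge0// ltW// (nuisance_B_gt0 nw).
- move=> a Sa; rewrite (le_trans (ler_normB _ _))// mulr2n mulrDl mul1r lerD//.
    exact: mz.
  exact: (intercept_le nw).
by rewrite -[X in (X <= _)%E]/(imputed_abs (D1 w, z)) Nzz leye_eq.
Qed.

Let sc (u : sample * obs R d k) j :=
  score S psi0 (muhat u.1) (pihat u.1) (phat u.1) u.2 j.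

Let msc j : measurable_fun setT (sc ^~ j).
Proof. exact: measurable_score. Qed.

Definition centered_score (D : sample) (z : obs R d k) (j : 'I_k) : R :=
  sc (D, z) j - \int[Q]_z' sc (D, z') j.

Definition mean_deviation (u : sample * sample) (j : 'I_k) : R :=
  n%:R^-1 * \sum_(i < n) centered_score u.1 (tnth u.2 i) j.

Let mcentered j :
  measurable_fun setT (fun u : sample * obs R d k => centered_score u.1 u.2 j).
Proof.
apply: measurable_funB; first exact: (msc j).
have := @measurable_Rintegral_param _ _ _ _ R Q setT (sc ^~ j) measurableT (msc j).
by move=> h; exact: (measurableT_comp h measurable_fst).
Qed.

Lemma measurable_mean_deviation j : measurable_fun setT (mean_deviation ^~ j).
Proof.
apply: measurable_funM => //; apply: measurable_sum => i.
have mt : measurable_fun setT (fun u : sample * sample => (u.1, tnth u.2 i)).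
  apply: measurable_fun_pair => //.
  exact: (measurableT_comp (measurable_tnth i)).
exact: (measurableT_comp (mcentered j) mt).
Qed.

Let c := 2 * (2 * B * (B / eps * B) + 2 * B ^+ 3).

(** A sum that dominates every coordinate, in place of a maximum, because it can be
integrated term by term. *)
Definition exp_deviation (lam : R) (u : sample * sample) : R :=
  \sum_j (expR (lam * mean_deviation u j) + expR (- (lam * mean_deviation u j))).

Lemma measurable_exp_deviation lam : measurable_fun setT (exp_deviation lam).
Proof.
apply: measurable_sum => j; have mj := measurable_mean_deviation j.
apply: measurable_funD; apply: (measurableT_comp (@measurable_expR R)).
  exact: measurable_funM.
by apply: measurableT_comp => //; exact: measurable_funM.
Qed.

(** Given the first sample, every coordinate is a mean of independent centered
variables bounded by [c]. *)
Lemma exp_deviation_le lam : (0 < n)%N ->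
  (\int[P]_w (exp_deviation lam (D1 w, D2 w))%:E <=
   (k%:R * (2 * expR (2 * (lam * c) ^+ 2 / n%:R)))%:E)%E.
Proof.
move=> n0.
apply: (@indep_integral_le _ _ _ _ _ _ _ P D1 D2
  (fun u => (exp_deviation lam u)%:E)) => //.
- by apply/measurable_EFinP; exact: measurable_exp_deviation.
- by move=> u; rewrite lee_fin sumr_ge0// => j _; rewrite addr_ge0 ?expR_ge0.
apply: filterS nuis => w nw.
have msw j : measurable_fun setT (fun z => sc (D1 w, z) j).
  exact: (measurableT_comp (msc j) (measurable_pair1 (D1 w))).
have scB j : {ae Q, forall z, `|sc (D1 w, z) j| <= 2 * B * (B / eps * B) + 2 * B ^+ 3}.
  by apply: filterS (score_bounded nw) => z; apply.
have mV j : measurable_fun setT (fun z => centered_score (D1 w) z j).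
  exact: (measurableT_comp (mcentered j) (measurable_pair1 (D1 w))).
have VB j : {ae Q, forall z, `|centered_score (D1 w) z j| <= c}.
  have mb := integral_ae_bounded_le (msw j) (scB j).
  apply: filterS (scB j) => z zB.
  by rewrite (le_trans (ler_normB _ _))// /c mulr2n mulrDl mul1r lerD.
have V0 j : \int[Q]_z centered_score (D1 w) z j = 0.
  rewrite RintegralB//.
  - by rewrite [X in _ - X]/Rintegral integral_cst_probability subrr.
  - exact: integrable_ae_bounded (msw j) (scB j).
  - exact: finite_measure_integrable_cst.
have mgf t j : (\int[P]_w' (expR (t * mean_deviation (D1 w, D2 w') j))%:E <=
    (expR (2 * (t * c) ^+ 2 / n%:R))%:E)%E.
  exact: (iid_mean_mgf t n0 iid2 (mV j) (VB j) (V0 j)).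
have mdev j : measurable_fun setT (fun w' => mean_deviation (D1 w, D2 w') j).
  apply: (measurableT_comp (measurable_mean_deviation j)).
  exact: measurable_fun_pair.
have mexp t j : measurable_fun setT
    (fun w' => (expR (t * mean_deviation (D1 w, D2 w') j))%:E).
  apply/measurable_EFinP; apply: (measurableT_comp (@measurable_expR R)).
  exact: measurable_funM.
have e0 x : (0 <= (expR x)%:E)%E by rewrite lee_fin expR_ge0.
under eq_integral => w' _.
  rewrite /exp_deviation -sumEFin.
  under eq_bigr do rewrite EFinD -mulNr.
  over.
rewrite ge0_integral_sum//; last 2 first.
- by move=> j; exact: emeasurable_funD.
- by move=> j w' _; rewrite adde_ge0.
apply: (@le_trans _ _ (\sum_(j < k) (2 * expR (2 * (lam * c) ^+ 2 / n%:R))%:E)%E).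
  apply: lee_sum => j _; rewrite ge0_integralD//.
  rewrite [leRHS](_ : _ = (expR (2 * (lam * c) ^+ 2 / n%:R))%:E +
     (expR (2 * (lam * c) ^+ 2 / n%:R))%:E)%E; last first.
    by rewrite -EFinD mulr2n mulrDl mul1r.
  by apply: leeD; rewrite ?mgf// -(sqrrN (lam * c)) -mulNr mgf.
by rewrite sumEFin sumr_const card_ord (mulr_natl _ k).
Qed.

End two_samples.

(** * The risk bound *)

Lemma filterS4 {T : Type} {F : set_system T} {fF : Filter F} (P1 P2 P3 P4 R : set T) :
  (forall x, P1 x -> P2 x -> P3 x -> P4 x -> R x) ->
  F P1 -> F P2 -> F P3 -> F P4 -> F R.
Proof.
move=> H F1 F2 F3 F4.
apply: filterS (filterI F1 (filterI F2 (filterI F3 F4))) => x [? [? [? ?]]].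
exact: H.
Qed.

(** For one coordinate of the score, with [x] its centered average and [b] its
bias. *)
Lemma sqr_le_of_deviation (R : realType) (x a b lam r : R) :
  0 < lam -> 0 <= r -> `|b| <= a ->
  (x + b) ^+ 2 <= 2 * a ^+ 2 + 2 * r ^+ 2 +
    2 * ((2 * r / lam + 4 / lam ^+ 2) * expR (- (lam * r))) *
    (expR (lam * x) + expR (- (lam * x))).
Proof.
move=> lam0 r0 ba; have := sqr_le_exp_tails x lam0 r0.
set K := _ * expR (- (lam * r)); set e := expR _ + expR _ => h.
have h1 : (x + b) ^+ 2 <= 2 * x ^+ 2 + 2 * b ^+ 2.
  by have := sqr_ge0 (x - b); lra.
have h2 : b ^+ 2 <= a ^+ 2.
  by rewrite -[leLHS]real_normK ?num_real// lerXn2r ?nnegrE// (le_trans _ ba).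
by rewrite -mulrA; lra.
Qed.

(** The exponent [lam] is chosen so that the exponential moment contributes
[k^(1/2)], and the threshold [r] so that [expR (- lam r) = k^-2]; with the [k]
coordinates the product is [k^(-1/2) <= 1].  Both [r^2] and the remaining factor
are of order [c^2 log k / n], since [log k >= 1/2]. *)
Lemma tuned_tail (R : realType) (k n : nat) (c : R) :
  (0 < n)%N -> (1 < k)%N -> 0 < c ->
  exists lam r : R, [/\ 0 < lam, 0 <= r &
  2 * r ^+ 2 + 2 * ((2 * r / lam + 4 / lam ^+ 2) * expR (- (lam * r))) *
    (k%:R * (2 * expR (2 * (lam * c) ^+ 2 / n%:R))) <=
  416 * c ^+ 2 * (ln k%:R / n%:R)].
Proof.
move=> n0 k1 c0.
have l2 := ln_nat_ge_half R k1.
set l := ln k%:R in l2 *.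
pose lam := Num.sqrt (n%:R * l) / (2 * c).
pose r := 4 * c * Num.sqrt (l / n%:R).
exists lam, r.
have l0 : 0 < l by lra.
have N0 : 0 < n%:R :> R by rewrite ltr0n.
have k0 : 0 < k%:R :> R by rewrite ltr0n ltnW.
have lam0 : 0 < lam by rewrite divr_gt0 ?sqrtr_gt0 ?mulr_gt0.
have r0 : 0 <= r by rewrite mulr_ge0 ?sqrtr_ge0// mulr_ge0// ltW.
have lam2 : lam ^+ 2 = n%:R * l / (4 * c ^+ 2).
  by rewrite exprMn exprVn sqr_sqrtr ?mulr_ge0 1?ltW//; field; rewrite gt_eqF.
have r2 : r ^+ 2 = 16 * c ^+ 2 * (l / n%:R).
  by rewrite exprMn sqr_sqrtr ?divr_ge0 1?ltW//; ring.
have lamr : lam * r = 2 * l.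
  have -> : lam * r = 2 * (Num.sqrt (n%:R * l) * Num.sqrt (l / n%:R)).
    by rewrite /lam /r; field; rewrite gt_eqF.
  rewrite -sqrtrM ?mulr_ge0 1?ltW//.
  have -> : n%:R * l * (l / n%:R) = l ^+ 2 by field; rewrite gt_eqF.
  by rewrite sqrtr_sqr ger0_norm// ltW.
split=> //.
have -> : 2 * r / lam = 16 * c ^+ 2 / n%:R.
  have -> : 2 * r / lam = 2 * (lam * r) / lam ^+ 2 by field; rewrite gt_eqF.
  by rewrite lamr lam2; field; rewrite !gt_eqF.
have -> : 2 * (lam * c) ^+ 2 / n%:R = l / 2.
  by rewrite exprMn lam2; field; rewrite !gt_eqF.
rewrite lamr lam2 r2.
have kE : k%:R = expR l by rewrite lnK// posrE.
have -> : 4 / (n%:R * l / (4 * c ^+ 2)) = 16 * c ^+ 2 / n%:R / l.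
  by field; rewrite !gt_eqF.
set q := c ^+ 2 / n%:R.
have q0 : 0 <= q by rewrite divr_ge0 ?exprn_ge0// ltW.
have -> : 16 * c ^+ 2 * (l / n%:R) = 16 * q * l by rewrite /q; ring.
have -> : 416 * c ^+ 2 * (l / n%:R) = 416 * q * l by rewrite /q; ring.
have -> : 16 * c ^+ 2 / n%:R = 16 * q by rewrite /q; ring.
have il : l^-1 <= 4 * l.
  by rewrite -[leLHS]mul1r ler_pdivrMr//; nra.
have e1 : expR (- (2 * l)) * (k%:R * (2 * expR (l / 2))) <= 2.
  rewrite kE.
  have -> : expR (- (2 * l)) * (expR l * (2 * expR (l / 2))) =
    2 * expR (l - 2 * l + l / 2) by rewrite !expRD; ring.
  have : expR (l - 2 * l + l / 2) <= 1 by rewrite -[leRHS]expR0 ler_expR; lra.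
  by lra.
set X := expR _ * _ in e1.
have X0 : 0 <= X by rewrite !mulr_ge0 ?expR_ge0// ltW.
have -> : 2 * (16 * q * l) + 2 * ((16 * q + 16 * q / l) * expR (- (2 * l))) *
    (k%:R * (2 * expR (l / 2))) = 32 * q * l + 32 * (q * (1 + l^-1)) * X.
  by rewrite /X; ring.
have qi : q * (1 + l^-1) <= q * (6 * l) by rewrite ler_wpM2l//; lra.
have il0 : 0 <= l^-1 by rewrite invr_ge0 ltW.
have qi0 : 0 <= q * (1 + l^-1) by rewrite mulr_ge0// addr_ge0.
have : q * (1 + l^-1) * X <= q * (6 * l) * 2 by rewrite ler_pM.
by rewrite -mulrA; lra.
Qed.

Theorem theorem6 (R : realType) (B C eps c : R) :
  0 < B -> 0 < C -> 0 < eps -> 0 < c ->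
  exists2 M : R, 0 < M &
  forall (d k n s : nat) (delta_n eps_n : R)
    (* the law of Z = (X, A, Y), regression function, conditional density *)
    (Q : probability (obs R d k) R)
    (mu pi_ : d.-tuple R -> k.-tuple R -> R)
    (* coefficients of the marginal structural model *)
    (psi0 : R) (psi : k.-tuple R)
    (* the two samples *)
    (dO : measure_display) (T : measurableType dO) (P : probability T R)
    (D1 D2 : {RV P >-> n.-tuple (obs R d k)})
    (* nuisance estimators, as functions of the first sample *)
    (muhat pihat : n.-tuple (obs R d k) -> d.-tuple R -> k.-tuple R -> R)
    (phat : n.-tuple (obs R d k) -> k.-tuple R -> R)
    (psihat : {RV P >-> k.-tuple R}),
  (0 < n)%N -> (1 < k)%N -> ln k%:R <= c * n%:R ->
  is_regression Q mu -> is_positive_cond_density Q pi_ ->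
  (* the linear marginal structural model, with s-sparse psi *)
  (forall a, suppA Q a ->
     (\int[Q]_z (mu (obsX z) a)%:E)%E = (psi0 + dotRn psi a)%:E) ->
  (l0norm psi <= s)%N ->
  (* two independent i.i.d. samples *)
  iid_sample D1 Q -> iid_sample D2 Q -> indep_rv D1 D2 ->
  (* the nuisance estimators are measurable; phat is nonnegative *)
  measurable_fun setT (fun u : n.-tuple (obs R d k) * (d.-tuple R * k.-tuple R)
    => muhat u.1 u.2.1 u.2.2) ->
  measurable_fun setT (fun u : n.-tuple (obs R d k) * (d.-tuple R * k.-tuple R)
    => pihat u.1 u.2.1 u.2.2) ->
  measurable_fun setT (fun u : n.-tuple (obs R d k) * k.-tuple R
    => phat u.1 u.2) ->
  (forall D a, 0 <= phat D a) ->
  (* (i) *)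
  {ae P, forall w, {ae Q, forall z, forall a, suppA Q a ->
     eps <= pihat (D1 w) (obsX z) a}} ->
  (* (ii) *)
  {ae P, forall w, forall l : R,
     eigenvalue (second_moment (suppA Q) (phat (D1 w))) l -> C <= l} ->
  (* (iii) *)
  {ae Q, forall z, `|obsY z| <= B} ->
  {ae P, forall w, {ae Q, forall z, forall a, suppA Q a ->
     `|muhat (D1 w) (obsX z) a| <= B}} ->
  `|psi0| <= B ->
  {ae Q, forall z, forall j : 'I_k, `|tnth (obsA z) j| <= B} ->
  {ae P, forall w, forall a, suppA Q a -> phat (D1 w) a <= B} ->
  {ae P, forall w,
     (\int[lebesgue_Rn k]_(a in suppA Q) (phat (D1 w) a)%:E <= B%:E)%E} ->
  (* nuisance errors, the first sample being held fixed *)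
  {ae P, forall w, forall a, suppA Q a ->
     (normX Q (fun x => (pi_ x a / pihat (D1 w) x a - 1)%R) <= delta_n%:E)%E} ->
  {ae P, forall w, forall a, suppA Q a ->
     (normX Q (fun x => (mu x a - muhat (D1 w) x a)%R) <= eps_n%:E)%E} ->
  (* psihat is either the Lasso or the best subset selection estimator *)
  {ae P, forall w,
     is_argmin [set beta | l1norm beta <= l1norm psi]
       (emp_risk (suppA Q) psi0 (muhat (D1 w)) (pihat (D1 w)) (phat (D1 w))
          (D2 w)) (psihat w)} \/
  {ae P, forall w,
     is_argmin [set beta | (l0norm beta <= s)%N]
       (emp_risk (suppA Q) psi0 (muhat (D1 w)) (pihat (D1 w)) (phat (D1 w))
          (D2 w)) (psihat w)} ->
  (\int[P]_w \int[lebesgue_Rn k]_(a in suppA Q)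
      (dotRn a (subRn (psihat w) psi) ^+ 2 * phat (D1 w) a)%:E
   <= (M * (s%:R * (ln k%:R / n%:R)
            + s%:R * (delta_n * eps_n) ^+ 2))%:E)%E.
Proof.
move=> B0 C0 eps0 _.
pose K := B / eps * B; pose c0 := 2 * (2 * B * K + 2 * B ^+ 3).
have K0 : 0 < K by apply: mulr_gt0 => //; exact: divr_gt0.
have c00 : 0 < c0.
  by have := exprn_gt0 3 B0; have := mulr_gt0 B0 K0; rewrite /c0; lra.
have M0 : 0 < 16 / C * (2 * B ^+ 4 + 416 * c0 ^+ 2).
  apply: mulr_gt0; first exact: divr_gt0.
  by have := exprn_gt0 4 B0; have := exprn_gt0 2 c00; lra.
exists (16 / C * (2 * B ^+ 4 + 416 * c0 ^+ 2)) => //.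
move=> d k n s dl en Q mu pi_ psi0 psi dO T P D1 D2 muhat pihat phat psihat.
move=> n0 k1 _ reg dens msm psis _ iid2 D12 mmu mpi mphat phat0 Hi Hii HY Hm.
move=> Hpsi0 HA Hphat Hmass Hpi Hmu Hest.
have nuis : {ae P, forall w, bounded_nuisance Q B eps psi0
    (muhat (D1 w)) (pihat (D1 w)) (phat (D1 w))}.
  have h1 : {ae P, forall w, {ae Q, forall z, forall a, suppA Q a ->
        eps <= pihat (D1 w) (obsX z) a} /\ {ae Q, forall z, forall a,
      suppA Q a -> `|muhat (D1 w) (obsX z) a| <= B}}.
    by move: Hi Hm; apply: filterS2 => w.
  have h2 : {ae P, forall w, (forall a, suppA Q a -> phat (D1 w) a <= B) /\
      (\int[lebesgue_Rn k]_(a in suppA Q) (phat (D1 w) a)%:E <= B%:E)%E}.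
    by move: Hphat Hmass; apply: filterS2 => w.
  move: h1 h2; apply: filterS2 => w [hi hm] [hf hmass].
  split => //.
  - exact: (measurableT_comp mmu (measurable_pair1 (D1 w))).
  - exact: (measurableT_comp mpi (measurable_pair1 (D1 w))).
  - exact: (measurableT_comp mphat (measurable_pair1 (D1 w))).
  - exact: suppA_bounded HA.
have good := ae_imputed_integrable iid2 D12 mmu mphat nuis.
have [lam [r [lam0 r0 tuned]]] := tuned_tail n0 k1 c00.
pose a := B ^+ 2 * (en * dl).
pose c1 := 2 * a ^+ 2 + 2 * r ^+ 2.
pose c2 := 2 * ((2 * r / lam + 4 / lam ^+ 2) * expR (- (lam * r))).
have c20 : 0 <= c2.
  by rewrite !mulr_ge0 ?expR_ge0// addr_ge0// divr_ge0 ?exprn_ge0 ?mulr_ge0 ?(ltW lam0).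
have c10 : 0 <= c1 by rewrite addr_ge0// mulr_ge0// sqr_ge0.
pose dev := exp_deviation Q psi0 muhat pihat phat.
have dev0 u : 0 <= dev lam u.
  by rewrite sumr_ge0// => j _; rewrite addr_ge0 ?expR_ge0.
pose F w := c1 + c2 * dev lam (D1 w, D2 w).
have F0 w : 0 <= F w by rewrite addr_ge0// mulr_ge0.
have key : {ae P, forall w,
    (\int[lebesgue_Rn k]_(a in suppA Q)
       (dotRn a (subRn (psihat w) psi) ^+ 2 * phat (D1 w) a)%:E <=
     (16 / C * s%:R * F w)%:E)%E}.
  have est : {ae P, forall w, emp_risk (suppA Q) psi0 (muhat (D1 w)) (pihat (D1 w))
      (phat (D1 w)) (D2 w) (psihat w) <=
      emp_risk (suppA Q) psi0 (muhat (D1 w)) (pihat (D1 w))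
      (phat (D1 w)) (D2 w) psi /\
      l1norm (subRn (psihat w) psi) ^+ 2 <=
        4 * s%:R * \sum_j tnth (subRn (psihat w) psi) j ^+ 2}.
    case: Hest => H; apply: filterS H => w [h1 h2]; split.
    - by apply: h2; rewrite /= lexx.
    - exact: l1_le_l2_lasso.
    - exact: h2.
    - exact: l1_le_l2_sparse.
  have err : {ae P, forall w, (forall a, suppA Q a ->
      (normX Q (fun x => (pi_ x a / pihat (D1 w) x a - 1)%R) <= dl%:E)%E) /\
      (forall a, suppA Q a ->
      (normX Q (fun x => (mu x a - muhat (D1 w) x a)%R) <= en%:E)%E)}.
    by move: Hpi Hmu; apply: filterS2 => w.
  have h1 : {ae P, forall w, bounded_nuisance Q B eps psi0
        (muhat (D1 w)) (pihat (D1 w)) (phat (D1 w)) /\ forall l : R,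
     eigenvalue (second_moment (suppA Q) (phat (D1 w))) l -> C <= l}.
    by move: nuis Hii; apply: filterS2 => w.
  move: h1 good err est; apply: filterS4 => w [nw eig] gw [pierr muerr] [risk cone].
  have [iq eq] := Rintegral_dot_dot nw (subRn (psihat w) psi).
  rewrite -[leLHS]fineK; last first.
    apply: integrable_fin_num => //; exact: measurable_suppA.
  rewrite lee_fin -/(Rintegral _ _ _) eq.
  have -> : \sum_j \sum_l tnth (subRn (psihat w) psi) j * tnth (subRn (psihat w) psi) l *
      second_moment (suppA Q) (phat (D1 w)) j l =
      bilin (second_moment (suppA Q) (phat (D1 w)))
        (rowRn (subRn (psihat w) psi)) (rowRn (subRn (psihat w) psi)).
    rewrite bilin_rowRn; apply: eq_bigr => j _; apply: eq_bigr => l _; ring.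
  move: risk; rewrite !(emp_risk_quadratic _ nw gw) => risk.
  apply: (argmin_excess_risk C0 (F0 w) _ eig _ risk cone).
    exact: second_moment_sym.
  move=> j.
  have bias := score_bias nw reg dens msm pierr muerr j.
  set sc := score _ _ _ _ _ in bias *.
  pose x := mean_deviation Q psi0 muhat pihat phat (D1 w, D2 w) j.
  have xE : n%:R^-1 * \sum_(i < n) sc (tnth (D2 w) i) j -
      \sum_l tnth psi l * second_moment (suppA Q) (phat (D1 w)) j l =
      x + (\int[Q]_z sc z j -
        \sum_l tnth psi l * second_moment (suppA Q) (phat (D1 w)) j l).
    rewrite /x /mean_deviation /centered_score sumrB sumr_const card_ord /=.
    rewrite -/sc mulrBr -[X in _ - _ * X]mulr_natl mulKf ?pnatr_eq0 -?lt0n//.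
    by ring.
  rewrite xE (le_trans (sqr_le_of_deviation x lam0 r0 bias))// -/a -/c1 -/c2.
  rewrite lerD2l ler_wpM2l// /dev /exp_deviation (bigD1 j)//= lerDl.
  by apply: sumr_ge0 => l _; apply: addr_ge0; exact: expR_ge0.
have mdev := measurable_exp_deviation Q psi0 mmu mpi mphat lam.
have mD12 : measurable_fun setT (fun w => (D1 w, D2 w)).
  exact: measurable_fun_pair.
have mdevw : measurable_fun setT (fun w => dev lam (D1 w, D2 w)).
  exact: (measurableT_comp mdev mD12).
have mF : measurable_fun setT F.
  by apply: measurable_funD => //; exact: measurable_funM.
apply: (@le_trans _ _ (\int[P]_w (16 / C * s%:R * F w)%:E)%E).
  apply: ae_ge0_le_integral => //.
  - move=> w _; apply: integral_ge0 => b _; rewrite lee_fin mulr_ge0// ?sqr_ge0//.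
  - pose g (v : T * k.-tuple R) : \bar R :=
      ((dotRn v.2 (subRn (psihat v.1) psi) ^+ 2 * phat (D1 v.1) v.2)%:E *
       (\1_(suppA Q) v.2)%:E)%E.
    have mj (j : 'I_k) : measurable_fun setT (fun b : k.-tuple R => tnth b j).
      exact: measurable_tnth.
    have mg : measurable_fun setT g.
      apply: emeasurable_funM; apply/measurable_EFinP; last first.
        have m1S : measurable_fun setT (\1_(suppA Q) : k.-tuple R -> R).
          by apply: measurable_indic; exact: measurable_suppA.
        exact: (measurableT_comp m1S measurable_snd).
      apply: measurable_funM.
        apply: measurable_funX; apply: measurable_sum => j.
        apply: measurable_funM; first exact: (measurableT_comp (mj j) measurable_snd).
        under eq_fun do rewrite tnth_mktuple.
        apply: measurable_funB => //.
        have mpsi : measurable_fun setT psihat by [].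
        exact: (measurableT_comp (mj j) (measurableT_comp mpsi measurable_fst)).
      have m2 : measurable_fun setT (fun v : T * k.-tuple R => (D1 v.1, v.2)).
        by apply: measurable_fun_pair => //; exact: measurableT_comp.
      exact: (measurableT_comp mphat m2).
    have g0 v : (0 <= g v)%E.
      by rewrite mule_ge0// lee_fin// mulr_ge0// sqr_ge0.
    have := measurable_fun_fubini_tonelli_F (m2 := lebesgue_Rn k) g mg g0.
    rewrite (_ : fubini_F _ _ = (fun w => \int[lebesgue_Rn k]_(a in suppA Q)
       (dotRn a (subRn (psihat w) psi) ^+ 2 * phat (D1 w) a)%:E)%E)//.
    apply/funext => w; rewrite /fubini_F [RHS]integral_mkcond.
    by apply: eq_integral => b _; rewrite epatch_indic.
  - by move=> w _; rewrite lee_fin !mulr_ge0// ?invr_ge0 ltW.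
  - by apply/measurable_EFinP; exact: measurable_funM.
  - by apply: filterS key.
have sC0 : 0 <= 16 / C * s%:R by rewrite !mulr_ge0// invr_ge0 ltW.
have devE := exp_deviation_le iid2 D12 mmu mpi mphat nuis lam n0.
have -> : (\int[P]_w (16 / C * s%:R * F w)%:E =
   (16 / C * s%:R)%:E * (c1%:E + c2%:E * \int[P]_w (dev lam (D1 w, D2 w))%:E))%E.
  under eq_integral do rewrite EFinM.
  rewrite ge0_integralZl//; last 2 first.
  - exact/measurable_EFinP.
  - by move=> w _; rewrite lee_fin.
  under eq_integral do rewrite EFinD.
  rewrite ge0_integralD//; last 2 first.
  - by move=> w _; rewrite lee_fin mulr_ge0.
  - by apply/measurable_EFinP; exact: measurable_funM.
  rewrite integral_cst_probability.
  under eq_integral do rewrite EFinM.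
  by rewrite ge0_integralZl//; [exact/measurable_EFinP|move=> w _; rewrite lee_fin].
apply: (@le_trans _ _ ((16 / C * s%:R)%:E * (c1%:E + c2%:E *
    (k%:R * (2 * expR (2 * (lam * c0) ^+ 2 / n%:R)))%:E))%E).
  rewrite lee_wpmul2l// leeD2l// lee_wpmul2l//.
rewrite -[(c2%:E * _)%E]EFinM -[(c1%:E + _)%E]EFinD -[leLHS]EFinM lee_fin.
set x := ln k%:R / n%:R in tuned *.
set y := (dl * en) ^+ 2.
have -> : 16 / C * (2 * B ^+ 4 + 416 * c0 ^+ 2) * (s%:R * x + s%:R * y) =
    16 / C * s%:R * ((2 * B ^+ 4 + 416 * c0 ^+ 2) * (x + y)) by ring.
apply: ler_wpM2l => //.
have x0 : 0 <= x.
  by apply: divr_ge0 => //; apply: le_trans (ln_nat_ge_half R k1).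
have y0 : 0 <= y by exact: sqr_ge0.
have aE : a ^+ 2 = B ^+ 4 * y by rewrite /a /y; ring.
have By : 0 <= B ^+ 4 * x by apply: mulr_ge0 => //; apply: exprn_ge0; exact: ltW.
have cx : 0 <= c0 ^+ 2 * y by apply: mulr_ge0 => //; exact: sqr_ge0.
rewrite /c1 aE -addrA -/c2 in tuned *.
by lra.
Qed.
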